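(* Let $(R_1,\mathcal L_1)$ and $(R_2,\mathcal L_2)$ be sets with a finite language. Suppose that Hilbert's tenth problem exists over $(R_1,\mathcal L_1)$ and over $(R_2,\mathcal L_2)$. Let $d:R_1\to R_2$ be an injective map. Suppose that for each of the following sets: (1) for all constants $c\in\mathcal L_1$, the set $\{d(c)\}$; (2) for all functions $f:R_1^k\to R_1$ of $\mathcal L_1$, the set $\{(d(x_1),\ldots,d(x_k),d(f(x_1,\ldots,x_k)))\mid\vec x\in R_1^k\}$; (3) for all relations $S\subset R_1^k$ of $\mathcal L_1$, the set $d(S)$; (4) the set $d(R_1)$, an explicit description of the form $$\{\vec x\in R_2^k\mid\exists\vec y\in R_2^l,\ \forall 1\le i\le n,\ (t_{i1}(\vec x,\vec y),\ldots,t_{in_i}(\vec x,\vec y))\in S_i\}$$ with $t_{ij}$ terms of $\mathcal L_2$ and $S_i$ relations of $\mathcal L_2$ is known. Then $d$ is an effective Diophantine map.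
   Context: $\mathbb N=\mathbb Z_{\ge0}$. A ''set with a language'' $(R,\mathcal L)$ is a set $R$ together with a language $\mathcal L$ (constants, functions, relations) with an interpretation in $R$; every language contains a constant $0$ and equality. Terms are built from constants of $\mathcal L$ and variables using functions of $\mathcal L$; basic formulas have the form $(t_1,\ldots,t_k)\in R'$ with $R'\in\mathcal L$ a $k$-ary relation (possibly equality) and $t_i$ terms. $S\subset R^k$ is Diophantine if $S=\{\vec x\in R^k\mid\exists\vec y\in R^l\ (f_1\wedge\cdots\wedge f_r)\}$ for some basic formulas $f_i$. $d(S)$ denotes coordinatewise image. $d:R_1\to R_2$ is a Diophantine map if $d(S)$ is Diophantine for all $k$ and all Diophantine $S\subset R_1^k$. Existence of Hilbert's tenth problem. $S_c(\mathcal L)$ is the set of constants of $\mathcal L$ and $S_c'(\mathcal L)=\{x\in R\mid\{x\}\text{ is Diophantine}\}$. A recursive ring is a ring with a recursive representation, i.e. an injection $j$ into $\mathbb N$ with recursive image for which addition and multiplication are recursive. A recursive ring $R_0$ with $S_c(\mathcal L)\subset R_0\subset S_c'(\mathcal L)$ is compatible with $(R,\mathcal L)$ if, for the language $\mathcal L'$ on $R_0$ having each constant $c\in\mathcal L$, the relation $S_f\cap R_0^{r+1}$ for each $r$-ary function $f\in\mathcal L$ (with $S_f=\{(\vec x,f(\vec x))\mid\vec x\in R^r\}$) and $S\cap R_0^r$ for each $r$-ary relation $S\in\mathcal L$, one has $S_c'(\mathcal L')=R_0$ and all relations of $\mathcal L'$ are recursive in $R_0$. Hilbert's tenth problem exists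 over $(R,\mathcal L)$ if $\mathcal L$ is countable and a compatible recursive ring $R_0$ with $S_c(\mathcal L)\subset R_0\subset S_c'(\mathcal L)$ exists. Coding. Let $R_i'$ be such a ring for $(R_i,\mathcal L_i)$ with representation $j_i$. For $(R,\mathcal L)=(R_i,\mathcal L_i)$, number the constants and functions injectively by $\mathrm{num}_{\mathcal L}$; put $\mathrm{sym}(l)=2^{\mathrm{num}_{\mathcal L}(l)}$ for constants and functions $l$, $\mathrm{sym}(x_n)=3^n$ for variables $x_n$, $\mathrm{sym}(r)=5^{j_i(r)}$ for $r\in R_i'$ (indices chosen so that different symbols get different codes). A term written in bracket-free prefix form as a string $s_1\cdots s_n$ gets number $J_i(s_1\cdots s_n)=\prod_m p_m^{\mathrm{sym}(s_m)}$, $p_m$ the $m$-th prime. Standing convention for this result: only the constants of $\mathcal L_i$ (not other elements of $R_i'$ or $S_c'(\mathcal L_i)$) are used as constants in terms and formulas. The relations of $\mathcal L_i$ (including equality) are numbered by natural numbers, and a finite system $(t_{11},\ldots)\in S_{i_1},\ldots,(t_{l1},\ldots)\in S_{i_l}$ is coded by the tuple $(l,i_1,J_i(t_{11}),\ldots,i_l,J_i(t_{l1}),\ldots)\in\bigcup_{n\ge0}\mathbb N^n$. Effective. A Diophantine map $d:R_1\to R_2$ is effective if there is a recursive function $D:\bigcup_{n\ge0}\mathbb N^n\to\bigcup_{n\ge0}\mathbb N^n$ that sends the code of every system $T$ of Diophantine equations in $\mathcal L_1$ (in variables $\vec x$) to the code of a system $D(T)$ in $\mathcal L_2$ (in variables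 $(\vec z,\vec y)$, $\vec z$ of the same length as $\vec x$) such that: (i) if $\vec x$ is a solution of $T$ over $R_1$, there is $\vec y$ such that $(d(\vec x),\vec y)$ is a solution of $D(T)$ over $R_2$; (ii) if $(\vec z,\vec y)$ is a solution of $D(T)$ over $R_2$, there is a solution $\vec x$ of $T$ with $\vec z=d(\vec x)$. *)

(* Defs.v *)
From mathcomp Require Import all_boot ssralg.
From mathcomp Require Import boolp classical_sets functions cardinality.

Set Implicit Arguments.
Unset Strict Implicit.
Unset Printing Implicit Defensive.

Local Open Scope classical_set_scope.

(* Total recursive functions nat^n -> nat, after Kleene: minimisation is only
   applied to regular functions, so every function of the class is total. *)
Inductive recursive : forall n, (n.-tuple nat -> nat) -> Prop :=
| rec_zero n : recursive (fun _ : n.-tuple nat => 0)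
| rec_succ : recursive (fun v : 1.-tuple nat => (thead v).+1)
| rec_proj n (i : 'I_n) : recursive (fun v : n.-tuple nat => tnth v i)
| rec_comp m n (g : m.-tuple nat -> nat) (h : 'I_m -> n.-tuple nat -> nat) :
    recursive g -> (forall i, recursive (h i)) ->
    recursive (fun v : n.-tuple nat => g [tuple h i v | i < m])
| rec_prec n (g : n.-tuple nat -> nat) (h : n.+2.-tuple nat -> nat)
    (f : n.+1.-tuple nat -> nat) :
    recursive g -> recursive h ->
    (forall v : n.-tuple nat, f [tuple of 0 :: v] = g v) ->
    (forall k (v : n.-tuple nat),
       f [tuple of k.+1 :: v] =
       h [tuple of k :: f [tuple of k :: v] :: v]) ->
    recursive f
| rec_min n (g : n.+1.-tuple nat -> nat) (f : n.-tuple nat -> nat) :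
    recursive g ->
    (forall v : n.-tuple nat, g [tuple of f v :: v] = 0) ->
    (forall (v : n.-tuple nat) m, m < f v -> g [tuple of m :: v] <> 0) ->
    recursive f.

Definition recursive_set n (S : set (n.-tuple nat)) : Prop :=
  exists2 b : n.-tuple nat -> bool,
    recursive (fun v => nat_of_bool (b v)) & forall v, S v <-> b v.

(* The union of the nat^n is [seq nat]; CodeSeq.code is an effective bijection
   from it onto nat. *)
Definition recursive_seq (D : seq nat -> seq nat) : Prop :=
  exists2 f : 1.-tuple nat -> nat,
    recursive f &
    forall s, f [tuple CodeSeq.code s] = CodeSeq.code (D s).

(* A language with its interpretation in R. Equality is not listed in [rel_sym]:
   the relations of the language are those of [relation] below. *)
Record language (R : Type) := Language {
  cst_sym : Type;
  fun_sym : Type;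
  rel_sym : Type;
  far : fun_sym -> nat;
  rar : rel_sym -> nat;
  czero : cst_sym;
  cint : cst_sym -> R;
  fint : forall f : fun_sym, (far f).-tuple R -> R;
  rint : forall S : rel_sym, set ((rar S).-tuple R) }.

Arguments fint {R l} f _.
Arguments rint {R l} S _.

Section Language.
Variables (R : Type) (L : language R).

Definition relation := option (rel_sym L).

Definition relar (S : relation) : nat := if S is Some S' then rar S' else 2.

Definition relint (S : relation) : set ((relar S).-tuple R) :=
  match S with
  | Some S' => rint S'
  | None => [set v : 2.-tuple R | thead v = thead (behead_tuple v)]
  end.

Arguments relint S _ : clear implicits.

Definition finite_language : Prop :=
  [/\ finite_set [set: cst_sym L], finite_set [set: fun_sym L]
    & finite_set [set: rel_sym L]].

Definition countable_language : Prop :=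
  [/\ countable [set: cst_sym L], countable [set: fun_sym L]
    & countable [set: rel_sym L]].

(* Terms and systems in the variables x_1, ..., x_n; [Var i] is x_(i+1). *)
Inductive term (n : nat) : Type :=
| Var of 'I_n
| Cst of cst_sym L
| App (f : fun_sym L) of ('I_(far f) -> term n).

Fixpoint eval n (x : n.-tuple R) (t : term n) : R :=
  match t with
  | Var i => tnth x i
  | Cst c => cint c
  | App f ts => fint f [tuple eval x (ts i) | i < far f]
  end.

Record basic_formula (n : nat) := BasicFormula {
  brel : relation;
  bargs : 'I_(relar brel) -> term n }.

Definition holds n (x : n.-tuple R) (b : basic_formula n) : Prop :=
  relint (brel b) [tuple eval x (bargs i) | i < relar (brel b)].

Definition system (n : nat) := seq (basic_formula n).

Fixpoint solution n (x : n.-tuple R) (T : system n) : Prop :=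
  if T is b :: T' then holds x b /\ solution x T' else True.

Definition diophantine k (S : set (k.-tuple R)) : Prop :=
  exists l (T : system (k + l)),
    S = [set x : k.-tuple R |
          exists y : l.-tuple R, solution [tuple of x ++ y] T].

(* S_c and S_c' *)
Definition constants : set R := range (@cint R L).
Definition dioph_constants : set R := [set x | diophantine [set [tuple x]]].

Definition graph (f : fun_sym L) : set ((far f).+1.-tuple R) :=
  [set [tuple of rcons x (fint f x)] | x in [set: (far f).-tuple R]].

End Language.

Arguments relar {R L}.
Arguments relint {R L} S _.
Arguments graph {R L} f _.
Arguments Var {R L n}.
Arguments Cst {R L n}.

Definition imaget (R1 R2 : Type) (d : R1 -> R2) k (S : set (k.-tuple R1)) :
  set (k.-tuple R2) := [set map_tuple d x | x in S].

Definition diophantine_map (R1 R2 : Type) (L1 : language R1)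
    (L2 : language R2) (d : R1 -> R2) : Prop :=
  forall k (S : set (k.-tuple R1)),
    diophantine L1 S -> diophantine L2 (imaget d S).

Definition recursive_representation (A : pzRingType) (j : A -> nat) : Prop :=
  [/\ injective j,
      recursive_set (imaget j [set: 1.-tuple A]),
      exists2 f : 2.-tuple nat -> nat, recursive f &
        forall a b, f [tuple j a; j b] = j (a + b)%R
    & exists2 f : 2.-tuple nat -> nat, recursive f &
        forall a b, f [tuple j a; j b] = j (a * b)%R].

(* The subset R_0 of R is given as a ring A with an injection i : A -> R, and
   [c0] names the constants of L in A. This is the language L' on R_0. *)
Section Restriction.
Variables (R : Type) (L : language R) (A : Type) (i : A -> R)
  (c0 : cst_sym L -> A).

Definition restrict_ar (S : fun_sym L + rel_sym L) : nat :=
  match S with inl f => (far f).+1 | inr S' => rar S' end.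

Definition restrict_int (S : fun_sym L + rel_sym L) :
    set ((restrict_ar S).-tuple A) :=
  match S with
  | inl f => [set a : (far f).+1.-tuple A | graph f (map_tuple i a)]
  | inr S' => [set a : (rar S').-tuple A | rint S' (map_tuple i a)]
  end.

Definition restrict_language : language A :=
  {| cst_sym := cst_sym L;
     fun_sym := void;
     rel_sym := (fun_sym L + rel_sym L)%type;
     far := of_void nat;
     rar := restrict_ar;
     czero := czero L;
     cint := c0;
     fint := fun f : void => match f with end;
     rint := restrict_int |}.

End Restriction.

Definition compatible (R : Type) (L : language R) (A : pzRingType)
    (j : A -> nat) (i : A -> R) (c0 : cst_sym L -> A) : Prop :=
  let L' := restrict_language i c0 in
  dioph_constants L' = [set: A] /\
  forall S : relation L', recursive_set (imaget j (relint S)).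

Definition hilbert10_exists (R : Type) (L : language R) : Prop :=
  countable_language L /\
  exists (A : pzRingType) (j : A -> nat) (i : A -> R) (c0 : cst_sym L -> A),
    [/\ recursive_representation j,
        injective i /\ (forall c, i (c0 c) = cint c),
        constants L `<=` range i,
        range i `<=` dioph_constants L
      & compatible j i c0].

Definition next_prime (n : nat) : nat :=
  ex_minn (let: exist2 p n_lt_p p_prime := prime_above n in
           ex_intro (fun q => (n < q) && prime q) p
             (introT andP (conj n_lt_p p_prime))).

(* nth_prime m is p_(m+1): 2, 3, 5, ... *)
Definition nth_prime (m : nat) : nat := iter m next_prime 2.

Definition string_code (s : seq nat) : nat :=
  \prod_(m < size s) nth_prime m ^ nth 0 s m.

Record numbering (R : Type) (L : language R) := Numbering {
  num : cst_sym L + fun_sym L -> nat;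
  num_inj : injective num;
  relnum : relation L -> nat;
  relnum_inj : injective relnum }.

Section Coding.
Variables (R : Type) (L : language R) (N : numbering L).

(* Variables are numbered from 1, so that the codes 3 ^ n of variables differ
   from the codes 2 ^ num of constants and functions. Terms involve no elements
   of R_0 other than the constants of L, hence no symbol coded 5 ^ j(r). *)
Fixpoint term_string n (t : term L n) : seq nat :=
  match t with
  | Var i => [:: 3 ^ i.+1]
  | Cst c => [:: 2 ^ num N (inl c)]
  | App f ts =>
      2 ^ num N (inr f) ::
      flatten [seq term_string (ts i) | i <- enum 'I_(far f)]
  end.

Definition term_code n (t : term L n) : nat := string_code (term_string t).

Definition formula_code n (b : basic_formula L n) : seq nat :=
  relnum N (brel b) ::
  [seq term_code (bargs i) | i <- enum 'I_(relar (brel b))].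

Definition system_code n (T : system L n) : seq nat :=
  size T :: flatten [seq formula_code b | b <- T].

End Coding.

Section Vars.
Variables (R : Type) (L : language R) (n : nat).

Fixpoint term_vars (t : term L n) : seq 'I_n :=
  match t with
  | Var i => [:: i]
  | Cst _ => [::]
  | App f ts => flatten [seq term_vars (ts i) | i <- enum 'I_(far f)]
  end.

Definition system_vars (T : system L n) : seq 'I_n :=
  flatten [seq flatten [seq term_vars (bargs i) | i <- enum 'I_(relar (brel b))]
          | b <- T].

(* The largest index of a variable x_1, x_2, ... that occurs in T. *)
Definition last_var (T : system L n) : nat := \max_(i <- system_vars T) i.+1.

End Vars.

(* The code of a system does not record its tuple of variables, so that tuple
   has to be read off from T: it is (x_1, ..., x_n) with x_n the last variable
   occurring in T. Otherwise D(T) would have to force infinitely many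
   unmentioned variables into the image of d. The tuple (z, y) is
   (x_1, ..., x_(n+l)). *)
Definition effective_diophantine_map (R1 R2 : Type) (L1 : language R1)
    (L2 : language R2) (N1 : numbering L1) (N2 : numbering L2)
    (d : R1 -> R2) : Prop :=
  diophantine_map L1 L2 d /\
  exists2 D : seq nat -> seq nat, recursive_seq D &
    forall n (T : system L1 n), last_var T = n ->
    exists l (DT : system L2 (n + l)),
      [/\ D (system_code N1 T) = system_code N2 DT,
          forall x : n.-tuple R1, solution x T ->
            exists y : l.-tuple R2,
              solution [tuple of map_tuple d x ++ y] DT
        & forall (z : n.-tuple R2) (y : l.-tuple R2),
            solution [tuple of z ++ y] DT ->
            exists2 x : n.-tuple R1, solution x T & z = map_tuple d x].

(* Main.v *)
Require Import Defs.
From mathcomp Require Import all_boot ssralg.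
From mathcomp Require Import boolp classical_sets functions cardinality.

(** A system of equations over the first structure is translated subterm by
    subterm.  Every occurrence of a constant or of a function symbol in it
    receives a new variable w, meant to hold the image by d of the value of the
    subterm, and the description of the graph of d of that symbol is
    instantiated at the variables of the arguments and at w; a formula whose
    relation is S becomes the description of d(S) at the variables of its
    arguments; and the description of d(R1) is instantiated at each of the n
    variables of the system.  Existential variables of the descriptions become
    fresh variables.  In a solution of the new system, the first n variables are
    images by d because of d(R1), hence, by induction on terms and injectivity
    of d, each w is the image of the value of its subterm, so that the original
    system is satisfied by the preimages.  Conversely a solution x gives one of
    the new system, where the first n variables are d(x) and the others are
    chosen one block after the other.  This equivalence is
    [read_system_spec].

    On codes, the translation reads the prime factorisation code of each term,
    then runs through the symbols from right to left with a stack of variables: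
    in prefix notation, a symbol of arity k finds its k arguments on top of the
    stack.  The language being finite, the finitely many descriptions are
    constants in finite tables.  The number n of variables is the largest
    exponent of 3 in a symbol, since the variable of index i, counted from 0, is
    coded by 3 ^ i.+1 and the other symbols are powers of 2.

    Recursiveness ([computable_translate]) is proved for functions between types
    of pairs and lists that are coded by numbers: those which are realised on
    codes by a recursive function contain the usual operations and are closed
    under iteration and folding along a list. *)

Set Implicit Arguments.
Unset Strict Implicit.
Unset Printing Implicit Defensive.

Local Open Scope classical_set_scope.

(** * Recursive functions of a few numbers *)

Lemma eq_recursive n (f g : n.-tuple nat -> nat) :
  f =1 g -> recursive f -> recursive g.
Proof. by move=> /funext ->. Qed.

Lemma recursive_nth n i : i < n -> recursive (fun v : n.-tuple nat => nth 0 v i).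
Proof.
move=> lt_in; apply: eq_recursive (rec_proj (Ordinal lt_in)) => v.
by rewrite (tnth_nth 0).
Qed.

(** Recursiveness of functions of one, two and three numbers, written without
    tuples. *)
Definition rec1 (f : nat -> nat) :=
  recursive (fun v : 1.-tuple nat => f (nth 0 v 0)).
Definition rec2 (f : nat -> nat -> nat) :=
  recursive (fun v : 2.-tuple nat => f (nth 0 v 0) (nth 0 v 1)).
Definition rec3 (f : nat -> nat -> nat -> nat) :=
  recursive (fun v : 3.-tuple nat => f (nth 0 v 0) (nth 0 v 1) (nth 0 v 2)).

Lemma recursive_rec1 n f (a : n.-tuple nat -> nat) :
  rec1 f -> recursive a -> recursive (fun v => f (a v)).
Proof.
move=> rf ra; pose h (i : 'I_1) := a.
have /(rec_comp rf) : forall i, recursive (h i) by [].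
by apply: eq_recursive => v; rewrite (nth_mktuple _ 0 (@Ordinal 1 0 isT)).
Qed.

Lemma recursive_rec2 n f (a b : n.-tuple nat -> nat) :
  rec2 f -> recursive a -> recursive b -> recursive (fun v => f (a v) (b v)).
Proof.
move=> rf ra rb; pose h (i : 'I_2) := if i : nat is 0 then a else b.
have /(rec_comp rf) : forall i, recursive (h i) by case=> [[|[]]].
apply: eq_recursive => v.
by rewrite (nth_mktuple _ 0 (@Ordinal 2 0 isT)) (nth_mktuple _ 0 (@Ordinal 2 1 isT)).
Qed.

Lemma recursive_rec3 n f (a b c : n.-tuple nat -> nat) :
  rec3 f -> recursive a -> recursive b -> recursive c ->
  recursive (fun v => f (a v) (b v) (c v)).
Proof.
move=> rf ra rb rc.
pose h (i : 'I_3) := if i : nat is i'.+1 then if i' is 0 then b else c else a.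
have /(rec_comp rf) : forall i, recursive (h i) by case=> [[|[|[]]]].
apply: eq_recursive => v.
by rewrite (nth_mktuple _ 0 (@Ordinal 3 0 isT)) (nth_mktuple _ 0 (@Ordinal 3 1 isT))
  (nth_mktuple _ 0 (@Ordinal 3 2 isT)).
Qed.

Lemma rec1_succ : rec1 S.
Proof.
apply: eq_recursive rec_succ => v; rewrite /thead (tnth_nth 0) //.
Qed.

Lemma recursive_cst n k : recursive (fun _ : n.-tuple nat => k).
Proof.
elim: k => [|k IHk]; first exact: rec_zero.
exact: recursive_rec1 rec1_succ IHk.
Qed.

(** Primitive recursion on the first argument, with one parameter [p]. *)
Lemma rec2_prec (f : nat -> nat -> nat) (g : nat -> nat)
    (h : nat -> nat -> nat -> nat) :
  rec1 g -> rec3 h -> (forall p, f 0 p = g p) ->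
  (forall k p, f k.+1 p = h k (f k p) p) -> rec2 f.
Proof.
by move=> rg rh f0 fS; apply: (rec_prec rg rh) => *; [exact: f0 | exact: fS].
Qed.

Lemma rec1_prec (f : nat -> nat) (h : nat -> nat -> nat) :
  rec2 h -> (forall k, f k.+1 = h k (f k)) -> rec1 f.
Proof.
move=> rh fS; have r : rec2 (fun k _ => f k).
  apply: (@rec2_prec _ (fun=> f 0) (fun k r _ => h k r)) => //.
    exact: recursive_cst.
  exact: recursive_rec2 rh (recursive_nth _) (recursive_nth _).
exact: recursive_rec2 r (recursive_nth (ltn0Sn 0)) (recursive_nth (ltn0Sn 0)).
Qed.

(** Minimisation with one parameter: [f p] is the least [m] such that
    [b m p]. *)
Lemma rec1_min (b : nat -> nat -> bool) (f : nat -> nat) :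
  rec2 (fun m p => b m p) -> (forall p, b (f p) p) ->
  (forall p m, m < f p -> ~~ b m p) -> rec1 f.
Proof.
move=> rb bf bN; have rneg : rec1 (fun n => 1 - n).
  by apply: (@rec1_prec _ (fun _ _ => 0)) => //; exact: recursive_cst.
(* The test [1 - b m p] vanishes exactly when [b m p] holds. *)
have := recursive_rec1 rneg rb.
move=> /(@rec_min 1 _ (fun v => f (nth 0 v 0))); apply.
- by move=> v /=; rewrite bf.
- by move=> v m /bN /= /negPf ->.
Qed.

(** Closes the goals about arguments that are projections or constants. *)
Ltac rec_args := try exact: recursive_nth; try exact: recursive_cst.

Lemma rec2_add : rec2 addn.
Proof.
apply: (@rec2_prec _ id (fun _ r _ => r.+1)) => //; rec_args.
exact: recursive_rec1 rec1_succ (recursive_nth _).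
Qed.

Lemma rec2_mul : rec2 muln.
Proof.
apply: (@rec2_prec _ (fun=> 0) (fun _ r p => p + r)) => //; rec_args.
apply: recursive_rec2 rec2_add _ _; rec_args.
Qed.

Lemma rec2_exp : rec2 expn.
Proof.
have r : rec2 (fun k p => p ^ k).
  apply: (@rec2_prec _ (fun=> 1) (fun _ r p => p * r)) => //; rec_args.
    by apply: recursive_rec2 rec2_mul _ _; rec_args.
  by move=> k p; rewrite expnS.
by apply: recursive_rec2 r _ _; rec_args.
Qed.

Lemma rec1_pred : rec1 predn.
Proof.
by apply: (@rec1_prec _ (fun k _ => k)) => //; rec_args.
Qed.

Lemma rec2_sub : rec2 subn.
Proof.
have r : rec2 (fun k p => p - k).
  apply: (@rec2_prec _ id (fun _ r _ => r.-1)) => //; rec_args.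
  - by apply: recursive_rec1 rec1_pred _; rec_args.
  - by move=> p; rewrite subn0.
  - by move=> k p; rewrite subnS.
by apply: recursive_rec2 r _ _; rec_args.
Qed.

Lemma rec3_if : rec3 (fun b x y => if b == 0 then y else x).
Proof.
have r0 : rec2 (fun k p => if k == 0 then p else 0).
  by apply: (@rec2_prec _ id (fun _ _ _ => 0)) => //; rec_args.
have r1 : rec2 (fun k p => if k == 0 then 0 else p).
  by apply: (@rec2_prec _ (fun=> 0) (fun _ _ p => p)) => //; rec_args.
have := recursive_rec2 rec2_add
  (recursive_rec2 r0 (recursive_nth (isT : 0 < 3)) (recursive_nth (isT : 2 < 3)))
  (recursive_rec2 r1 (recursive_nth (isT : 0 < 3)) (recursive_nth (isT : 1 < 3))).
by apply: eq_recursive => v; case: eqP; rewrite ?addn0.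
Qed.

Lemma rec1_odd : rec1 (fun n => odd n).
Proof.
apply: (@rec1_prec _ (fun _ r => 1 - r)) => [|k]; last by rewrite /=; case: odd.
by apply: recursive_rec2 rec2_sub _ _; rec_args.
Qed.

Lemma rec1_half : rec1 half.
Proof.
apply: (@rec1_prec _ (fun k r => odd k + r)) => [|k]; last by rewrite /= uphalf_half.
apply: recursive_rec2 rec2_add _ _; rec_args.
by apply: recursive_rec1 rec1_odd _; rec_args.
Qed.

(** A pairing of numbers with its two projections.  Consing in [CodeSeq.code]
    is this pairing, with the empty list coded by the number 0, which is not a
    pair. *)
Definition npair a b := 2 ^ a * b.*2.+1.
Definition nfst c := logn 2 c.
Definition nsnd c := (c %/ 2 ^ logn 2 c)./2.

Lemma npairK1 a b : nfst (npair a b) = a.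
Proof.
rewrite /nfst /npair lognM ?expn_gt0 // lognX logn_prime // muln1.
by rewrite (@lognE 2 _.+1) /= dvdn2 /= odd_double addn0.
Qed.

Lemma npairK2 a b : nsnd (npair a b) = b.
Proof.
rewrite /nsnd -/(nfst _) npairK1 /npair mulKn ?expn_gt0 //.
by rewrite -[_.+1]/(true + _)%N half_bit_double.
Qed.

Lemma rec2_npair : rec2 npair.
Proof.
apply: recursive_rec2 rec2_mul _ _.
  by apply: recursive_rec2 rec2_exp _ _; rec_args.
apply: recursive_rec1 rec1_succ _.
have: recursive (fun v : 2.-tuple nat => nth 0 v 1 + nth 0 v 1).
  by apply: recursive_rec2 rec2_add _ _; rec_args.
by apply: eq_recursive => v; rewrite addnn.
Qed.

Lemma rec2_iter_half : rec2 (fun k c => c %/ 2 ^ k).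
Proof.
apply: (@rec2_prec _ id (fun _ r _ => r./2)) => //; rec_args.
- by apply: recursive_rec1 rec1_half _; rec_args.
- by move=> c; rewrite divn1.
- by move=> k c; rewrite expnSr divnMA divn2.
Qed.

(** [nfst c] is found by minimisation, as the number of halvings of [c] that
    lead to an odd number; the disjunct [c == 0] makes the search total. *)
Lemma rec1_nfst : rec1 nfst.
Proof.
have r : rec2 (fun m c => (c == 0) || odd (c %/ 2 ^ m)).
  have : recursive (fun v : 2.-tuple nat => if nth 0 v 1 == 0 then 1
     else odd (nth 0 v 1 %/ 2 ^ nth 0 v 0)).
    apply: (recursive_rec3 rec3_if (a := fun v => nth 0 v 1)); rec_args.
    apply: recursive_rec1 rec1_odd _.
    by apply: recursive_rec2 rec2_iter_half _ _; rec_args.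
  by apply: eq_recursive => v; case: eqP.
apply: (rec1_min r) => [c|c m]; rewrite /nfst.
  case: posnP => //= c_gt0; rewrite -[odd _]negbK -dvdn2.
  by rewrite dvdn_divRL ?pfactor_dvdnn // -expnS pfactor_dvdn // ltnn.
case: posnP => [->|c_gt0] //= lt_m; rewrite -dvdn2.
by rewrite dvdn_divRL -?expnS pfactor_dvdn // ltnW.
Qed.

Lemma rec1_nsnd : rec1 nsnd.
Proof.
apply: recursive_rec1 rec1_half _.
apply: recursive_rec2 rec2_iter_half _ _; rec_args.
exact: rec1_nfst.
Qed.

(** * Computable functions between encodable types *)

(** Types whose elements are coded by numbers. *)
Class encodable (A : Type) := enc : A -> nat.

#[global] Instance encodable_nat : encodable nat := id.
#[global] Instance encodable_bool : encodable bool := nat_of_bool.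
#[global] Instance encodable_prod A B {eA : encodable A} {eB : encodable B} :
  encodable (A * B) := fun p => npair (enc p.1) (enc p.2).
(** On [seq nat] this is [CodeSeq.code]. *)
#[global] Instance encodable_seq A {eA : encodable A} : encodable (seq A) :=
  foldr (fun x c => npair (enc x) c) 0.

(** A function is computable if some recursive function realises it on codes;
    the values of the latter on numbers that are not codes do not matter. *)
Definition computable A B {eA : encodable A} {eB : encodable B} (f : A -> B) :=
  exists2 g, rec1 g & forall a, g (enc a) = enc (f a).

Lemma eq_computable A B {eA : encodable A} {eB : encodable B} (f g : A -> B) :
  f =1 g -> computable f -> computable g.
Proof. by move=> /funext ->. Qed.

(** The closure properties are stated for functions of a context [c : C], so
    that a computability goal is decomposed along the syntax of the body of the
    function; bound variables enlarge the context with a product. *)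
Section Closure.
Context {C : Type} {eC : encodable C}.

Lemma computable_id : computable (fun c : C => c).
Proof. by exists id => //; exact: recursive_nth. Qed.

Lemma computable_cst {B} {eB : encodable B} (b : B) : computable (fun _ : C => b).
Proof. by exists (fun=> enc b) => //; exact: recursive_cst. Qed.

Lemma computable_comp {A B} {eA : encodable A} {eB : encodable B}
    (f : A -> B) (a : C -> A) :
  computable f -> computable a -> computable (fun c => f (a c)).
Proof.
move=> [g rg gE] [h rh hE]; exists (fun c => g (h c)) => [|c].
  exact: recursive_rec1 rg rh.
by rewrite hE gE.
Qed.

Lemma computable_rec1 f (a : C -> nat) :
  rec1 f -> computable a -> computable (fun c => f (a c)).
Proof. by move=> rf; apply: (@computable_comp nat nat); exists f. Qed.

Lemma computable_rec2 f (a b : C -> nat) :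
  rec2 f -> computable a -> computable b -> computable (fun c => f (a c) (b c)).
Proof.
move=> rf [g rg gE] [h rh hE]; exists (fun c => f (g c) (h c)) => [|c].
  exact: recursive_rec2 rf rg rh.
by rewrite gE hE.
Qed.

Lemma computable_pair {A B} {eA : encodable A} {eB : encodable B}
    (a : C -> A) (b : C -> B) :
  computable a -> computable b -> computable (fun c => (a c, b c)).
Proof. exact: (computable_rec2 rec2_npair). Qed.

Lemma computable_fst {A B} {eA : encodable A} {eB : encodable B}
    (a : C -> A * B) : computable a -> computable (fun c => (a c).1).
Proof.
apply: (computable_comp (f := fst)); exists nfst; first exact: rec1_nfst.
by move=> p; exact: npairK1.
Qed.

Lemma computable_snd {A B} {eA : encodable A} {eB : encodable B}
    (a : C -> A * B) : computable a -> computable (fun c => (a c).2).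
Proof.
apply: (computable_comp (f := snd)); exists nsnd; first exact: rec1_nsnd.
by move=> p; exact: npairK2.
Qed.

Lemma computable_if {A} {eA : encodable A} (b : C -> bool) (f g : C -> A) :
  computable b -> computable f -> computable g ->
  computable (fun c => if b c then f c else g c).
Proof.
move=> [b' rb bE] [f' rf fE] [g' rg gE].
exists (fun c => if b' c == 0 then g' c else f' c).
  exact: recursive_rec3 rec3_if rb rf rg.
by move=> c; rewrite bE fE gE; case: (b c).
Qed.

Lemma computable_cons {A} {eA : encodable A} (x : C -> A) (s : C -> seq A) :
  computable x -> computable s -> computable (fun c => x c :: s c).
Proof. exact: (computable_rec2 rec2_npair). Qed.

Lemma computable_case {X A} {eX : encodable X} {eA : encodable A}
    (f : C -> X -> seq X -> A) (z : C -> A) (s : C -> seq X) :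
  computable (fun p : C * (X * seq X) => f p.1 p.2.1 p.2.2) ->
  computable z -> computable s ->
  computable (fun c => if s c is x :: s' then f c x s' else z c).
Proof.
move=> [f' rf fE] [z' rz zE] [s' rs sE].
exists (fun c => if s' c == 0 then z' c else f' (npair c (s' c))).
  apply: recursive_rec3 rec3_if _ _ _ => //.
  apply: recursive_rec1 rf _.
  by apply: recursive_rec2 rec2_npair _ _ => //; exact: recursive_nth.
move=> c; rewrite sE zE; case: (s c) => [|x t] //=.
rewrite ifN; last by rewrite -lt0n muln_gt0 expn_gt0.
exact: (fE (c, (x, t))).
Qed.

Lemma computable_iter {A} {eA : encodable A} (f : C -> A -> A)
    (n : C -> nat) (a : C -> A) :
  computable (fun p : C * A => f p.1 p.2) -> computable n -> computable a ->
  computable (fun c => iter (n c) (f c) (a c)).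
Proof.
move=> [f' rf fE] [n' rn nE] [a' ra aE].
pose h k p := iter k (fun r => f' (npair (nfst p) r)) (nsnd p).
have rh : rec2 h.
  apply: (@rec2_prec _ nsnd (fun _ r p => f' (npair (nfst p) r))) => //.
    exact: rec1_nsnd.
  apply: recursive_rec1 rf _.
  apply: recursive_rec2 rec2_npair _ _; last exact: recursive_nth.
  by apply: recursive_rec1 rec1_nfst _; exact: recursive_nth.
exists (fun c => h (n' c) (npair c (a' c))).
  apply: recursive_rec2 rh _ _ => //.
  by apply: recursive_rec2 rec2_npair _ _ => //; exact: recursive_nth.
move=> c; rewrite nE aE /h npairK1 npairK2; change (enc (n c)) with (n c).
by elim: (n c) => //= k ->; rewrite (fE (c, _)).
Qed.

Lemma computable_S (a : C -> nat) : computable a -> computable (fun c => (a c).+1).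
Proof. exact: (computable_rec1 rec1_succ). Qed.

Lemma computable_pred (a : C -> nat) : computable a -> computable (fun c => (a c).-1).
Proof. exact: (computable_rec1 rec1_pred). Qed.

Lemma computable_add (a b : C -> nat) :
  computable a -> computable b -> computable (fun c => a c + b c).
Proof. exact: (computable_rec2 rec2_add). Qed.

Lemma computable_mul (a b : C -> nat) :
  computable a -> computable b -> computable (fun c => a c * b c).
Proof. exact: (computable_rec2 rec2_mul). Qed.

Lemma computable_exp (a b : C -> nat) :
  computable a -> computable b -> computable (fun c => a c ^ b c).
Proof. exact: (computable_rec2 rec2_exp). Qed.

Lemma computable_sub (a b : C -> nat) :
  computable a -> computable b -> computable (fun c => a c - b c).
Proof. exact: (computable_rec2 rec2_sub). Qed.

Lemma computable_negb (a : C -> bool) : computable a -> computable (fun c => ~~ a c).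
Proof.
move=> ca; have : computable (fun c => if a c then false else true).
  by apply: computable_if => //; exact: computable_cst.
by apply: eq_computable => c; case: (a c).
Qed.

Lemma computable_and (a b : C -> bool) :
  computable a -> computable b -> computable (fun c => a c && b c).
Proof. by move=> ca cb; apply: computable_if => //; exact: computable_cst. Qed.

Lemma computable_or (a b : C -> bool) :
  computable a -> computable b -> computable (fun c => a c || b c).
Proof. by move=> ca cb; apply: computable_if => //; exact: computable_cst. Qed.

Lemma computable_eq0 (a : C -> nat) : computable a -> computable (fun c => a c == 0).
Proof.
move=> [g rg gE]; exists (fun c => 1 - g c).
  by apply: recursive_rec2 rec2_sub _ _ => //; exact: recursive_cst.
by move=> c; rewrite gE; change (enc (a c)) with (a c); case: (a c).
Qed.

Lemma computable_leq (a b : C -> nat) :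
  computable a -> computable b -> computable (fun c => a c <= b c).
Proof. by move=> ca cb; apply/computable_eq0/computable_sub. Qed.

Lemma computable_eqn (a b : C -> nat) :
  computable a -> computable b -> computable (fun c => a c == b c).
Proof.
move=> ca cb.
have : computable (fun c => (a c <= b c) && (b c <= a c)).
  by apply: computable_and; apply: computable_leq.
by apply: eq_computable => c; rewrite eqn_leq.
Qed.

Lemma computable2 {A B D} {eA : encodable A} {eB : encodable B}
    {eD : encodable D} (f : A -> B -> D) (a : C -> A) (b : C -> B) :
  computable (fun p : A * B => f p.1 p.2) -> computable a -> computable b ->
  computable (fun c => f (a c) (b c)).
Proof.
move=> cf ca cb.
apply: (computable_comp (f := fun p => f p.1 p.2) (a := fun c => (a c, b c))).
  exact: cf.
exact: computable_pair.
Qed.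

End Closure.

Section ClosureSeq.
Context {C : Type} {eC : encodable C}.

(** The code of a list bounds the number of steps needed to consume it. *)
Lemma leq_size_enc {A} {eA : encodable A} (s : seq A) : size s <= enc s.
Proof.
elim: s => //= x s IHs; apply: leq_trans (leq_pmull _ (expn_gt0 2 (enc x))).
by rewrite ltnS (leq_trans IHs) // -addnn leq_addr.
Qed.

Lemma computable_foldl {X A} {eX : encodable X} {eA : encodable A}
    (f : C -> A -> X -> A) (z : C -> A) (s : C -> seq X) :
  computable (fun p : C * A * X => f p.1.1 p.1.2 p.2) ->
  computable z -> computable s ->
  computable (fun c => foldl (f c) (z c) (s c)).
Proof.
move=> cf cz cs.
(* One step consumes the head of the list held in the first component. *)
pose step c (q : seq X * A) := if q.1 is x :: t then (t, f c q.2 x) else q.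
have cstep : computable (fun p : C * (seq X * A) => step p.1 p.2).
  apply: (computable_case (f := fun p x t => (t, f p.1 p.2.2 x))
    (z := snd) (s := fun p => p.2.1)).
  - apply: computable_pair; first exact/computable_snd/computable_snd/computable_id.
    apply: (computable_comp (f := fun p : C * A * X => f p.1.1 p.1.2 p.2)
      (a := fun p => (p.1.1, p.1.2.2, p.2.1))) => //.
    apply: computable_pair; last exact/computable_fst/computable_snd/computable_id.
    apply: computable_pair; first exact/computable_fst/computable_fst/computable_id.
    exact/computable_snd/computable_snd/computable_fst/computable_id.
  - exact/computable_snd/computable_id.
  - exact/computable_fst/computable_snd/computable_id.
have : computable (fun c => (iter (enc (s c)) (step c) (s c, z c)).2).
  apply: computable_snd; apply: computable_iter => //.
  exact: computable_pair.
apply: eq_computable => c.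
suff iterE : forall t n a,
    size t <= n -> (iter n (step c) (t, a)).2 = foldl (f c) a t.
  exact/iterE/leq_size_enc.
elim=> [|x t IHt] n a /=.
  have stepE : step c ([::], a) = ([::], a) by [].
  by rewrite iter_fix.
by case: n => // n le_tn; rewrite iterSr IHt.
Qed.

Lemma computable_rev {A} {eA : encodable A} (s : C -> seq A) :
  computable s -> computable (fun c => rev (s c)).
Proof.
move=> cs; have : computable (fun c => foldl (fun a x => x :: a) [::] (s c)).
  apply: computable_foldl => //; last exact: computable_cst.
  apply: computable_cons; first exact/computable_snd/computable_id.
  exact/computable_snd/computable_fst/computable_id.
apply: eq_computable => c; rewrite /rev.
by elim: (s c) [::] => //= x t IHt a; rewrite IHt.
Qed.

Lemma computable_foldr {X A} {eX : encodable X} {eA : encodable A}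
    (f : C -> X -> A -> A) (z : C -> A) (s : C -> seq X) :
  computable (fun p : C * X * A => f p.1.1 p.1.2 p.2) ->
  computable z -> computable s ->
  computable (fun c => foldr (f c) (z c) (s c)).
Proof.
move=> cf cz cs.
have : computable (fun c => foldl (fun a x => f c x a) (z c) (rev (s c))).
  apply: computable_foldl => //; last exact: computable_rev.
  apply: (computable_comp (f := fun p : C * X * A => f p.1.1 p.1.2 p.2)
    (a := fun p => (p.1.1, p.2, p.1.2))) => //.
  apply: computable_pair; last exact/computable_snd/computable_fst/computable_id.
  apply: computable_pair; first exact/computable_fst/computable_fst/computable_id.
  exact/computable_snd/computable_id.
by apply: eq_computable => c; rewrite foldl_rev.
Qed.

End ClosureSeq.

(** Decomposes a computability goal along the head symbol of its body. *)
Ltac computability_step := cbv beta; lazymatch goal with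
  | |- computable (fun _ => ?b) => exact: computable_cst
  | |- computable (fun c => c) => exact: computable_id
  | |- computable (fun c => fst _) => apply: computable_fst
  | |- computable (fun c => snd _) => apply: computable_snd
  | |- computable (fun c => (_, _)) => apply: computable_pair
  | |- computable (fun c => S _) => apply: computable_S
  | |- computable (fun c => predn _) => apply: computable_pred
  | |- computable (fun c => addn _ _) => apply: computable_add
  | |- computable (fun c => muln _ _) => apply: computable_mul
  | |- computable (fun c => expn _ _) => apply: computable_exp
  | |- computable (fun c => subn _ _) => apply: computable_sub
  | |- computable (fun c => andb _ _) => apply: computable_and
  | |- computable (fun c => orb _ _) => apply: computable_or
  | |- computable (fun c => negb _) => apply: computable_negb
  | |- computable (fun c => leq _ _) => apply: computable_leq
  | |- computable (fun c => eq_op _ _) => apply: computable_eqn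
  | |- computable (fun c => if _ then _ else _) => apply: computable_if
  | |- computable (fun c => cons _ _) => apply: computable_cons
  | |- computable (fun c => rev _) => apply: computable_rev
  | |- computable (fun c => iter _ _ _) => apply: computable_iter
  | |- computable (fun c => foldr _ _ _) => apply: computable_foldr
  | |- computable fst => apply: (computable_fst computable_id)
  | |- computable snd => apply: (computable_snd computable_id)
  | |- @computable ?A ?B ?eA ?eB ?f => first [assumption | lazymatch f with
      | fun _ => _ => fail
      | _ => change (@computable A B eA eB (fun c => f c))
      end]
  end.
Ltac computability := repeat computability_step.

(** * Computability of list functions and of arithmetic *)

Section ListMaps.
Context {C : Type} {eC : encodable C}.

Lemma computable_map {X A} {eX : encodable X} {eA : encodable A}
    (f : C -> X -> A) (s : C -> seq X) :
  computable (fun p : C * X => f p.1 p.2) -> computable s ->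
  computable (fun c => [seq f c x | x <- s c]).
Proof.
move=> cf cs.
change (computable (fun c => foldr (fun x a => f c x :: a) [::] (s c))).
by computability; apply: (computable2 cf); computability.
Qed.

Lemma computable_filter {X} {eX : encodable X} (p : C -> X -> bool)
    (s : C -> seq X) :
  computable (fun q : C * X => p q.1 q.2) -> computable s ->
  computable (fun c => [seq x <- s c | p c x]).
Proof.
move=> cp cs.
change (computable (fun c =>
  foldr (fun x a => if p c x then x :: a else a) [::] (s c))).
by computability; apply: (computable2 cp); computability.
Qed.

Lemma computable_all {X} {eX : encodable X} (p : C -> X -> bool)
    (s : C -> seq X) :
  computable (fun q : C * X => p q.1 q.2) -> computable s ->
  computable (fun c => all (p c) (s c)).
Proof.
move=> cp cs.
change (computable (fun c => foldr (fun x a => p c x && a) true (s c))).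
by computability; apply: (computable2 cp); computability.
Qed.

Lemma computable_has {X} {eX : encodable X} (p : C -> X -> bool)
    (s : C -> seq X) :
  computable (fun q : C * X => p q.1 q.2) -> computable s ->
  computable (fun c => has (p c) (s c)).
Proof.
move=> cp cs.
change (computable (fun c => foldr (fun x a => p c x || a) false (s c))).
by computability; apply: (computable2 cp); computability.
Qed.

Lemma computable_cat {A} {eA : encodable A} (s t : C -> seq A) :
  computable s -> computable t -> computable (fun c => s c ++ t c).
Proof.
move=> cs ct; have : computable (fun c => foldr cons (t c) (s c)) by computability.
by apply: eq_computable => c; elim: (s c) => //= x u ->.
Qed.

Lemma computable_size {A} {eA : encodable A} (s : C -> seq A) :
  computable s -> computable (fun c => size (s c)).
Proof.
move=> cs.
have : computable (fun c => foldr (fun _ n => n.+1) 0 (s c)) by computability.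
by apply: eq_computable => c; elim: (s c) => //= x u ->.
Qed.

Lemma computable_behead {A} {eA : encodable A} (s : C -> seq A) :
  computable s -> computable (fun c => behead (s c)).
Proof.
move=> cs; apply: (computable_case (f := fun _ _ t => t) (z := fun=> [::])) => //.
  by computability.
by computability.
Qed.

Lemma computable_head {A} {eA : encodable A} (x0 : A) (s : C -> seq A) :
  computable s -> computable (fun c => head x0 (s c)).
Proof.
move=> cs; apply: (computable_case (f := fun _ x _ => x) (z := fun=> x0)) => //.
  by computability.
by computability.
Qed.

End ListMaps.

Section ListSurgery.
Context {C : Type} {eC : encodable C}.

Lemma computable_flatten {A} {eA : encodable A} (s : C -> seq (seq A)) :
  computable s -> computable (fun c => flatten (s c)).
Proof.
move=> cs; apply: computable_foldr => //; computability.
by apply: computable_cat; computability.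
Qed.

Lemma computable_drop {A} {eA : encodable A} (n : C -> nat) (s : C -> seq A) :
  computable n -> computable s -> computable (fun c => drop (n c) (s c)).
Proof.
move=> cn cs; have : computable (fun c => iter (n c) behead (s c)).
  by computability; apply: computable_behead; computability.
apply: eq_computable => c; elim: (n c) (s c) => [|k IHk] t; first by rewrite drop0.
by rewrite iterSr IHk; case: t.
Qed.

Lemma computable_take {A} {eA : encodable A} (n : C -> nat) (s : C -> seq A) :
  computable n -> computable s -> computable (fun c => take (n c) (s c)).
Proof.
move=> cn cs.
have : computable (fun c => rev (drop (size (s c) - n c) (rev (s c)))).
  computability; apply: computable_drop; computability.
  by apply: computable_size; computability.
apply: eq_computable => c; rewrite drop_rev revK.
case: (leqP (n c) (size (s c))) => [le_n|/ltnW le_s]; first by rewrite subKn.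
by rewrite (eqnP le_s) subn0 !take_oversize.
Qed.

Lemma computable_nth {A} {eA : encodable A} (x0 : A) (n : C -> nat)
    (s : C -> seq A) :
  computable n -> computable s -> computable (fun c => nth x0 (s c) (n c)).
Proof.
move=> cn cs; have : computable (fun c => head x0 (drop (n c) (s c))).
  by apply: computable_head; exact: computable_drop.
by apply: eq_computable => c; rewrite -nth0 nth_drop addn0.
Qed.

Lemma computable_iota (m n : C -> nat) :
  computable m -> computable n -> computable (fun c => iota (m c) (n c)).
Proof.
move=> cm cn.
have : computable (fun c => rev (iter (n c) (fun s => m c + size s :: s) [::])).
  by computability; [apply: (computable_comp cm)|apply: computable_size]; computability.
apply: eq_computable => c; elim: (n c) => // k IHk.
rewrite -addn1 iotaD addn1 iterS rev_cons -cats1 IHk.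
by rewrite -(size_rev (iter _ _ _)) IHk size_iota.
Qed.

End ListSurgery.

(** Extends the tactic [computability] to list functions. *)
Ltac computability_seq_step := first [computability_step
  | cbv beta; lazymatch goal with
  | |- computable (fun c => map _ _) => apply: computable_map
  | |- computable (fun c => filter _ _) => apply: computable_filter
  | |- computable (fun c => all _ _) => apply: computable_all
  | |- computable (fun c => has _ _) => apply: computable_has
  | |- computable (fun c => cat _ _) => apply: computable_cat
  | |- computable (fun c => size _) => apply: computable_size
  | |- computable (fun c => head _ _) => apply: computable_head
  | |- computable (fun c => behead _) => apply: computable_behead
  | |- computable (fun c => flatten _) => apply: computable_flatten
  | |- computable (fun c => drop _ _) => apply: computable_drop
  | |- computable (fun c => take _ _) => apply: computable_take
  | |- computable (fun c => nth _ _ _) => apply: computable_nth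
  | |- computable (fun c => iota _ _) => apply: computable_iota
  end].
Ltac computability ::= repeat computability_seq_step.

Lemma computable_dvdn {C : Type} {eC : encodable C} (a b : C -> nat) :
  computable a -> computable b -> computable (fun c => a c %| b c).
Proof.
move=> ca cb.
have : computable (fun c => has (fun q => q * a c == b c) (iota 0 (b c).+1)).
  computability; [apply: (computable_comp ca) | apply: (computable_comp cb)];
    computability.
apply: eq_computable => c.
apply/hasP/dvdnP => [[q _ /eqP <-]|[q bE]]; first by exists q.
have [a0|a_gt0] := posnP (a c); first by exists 0; rewrite ?bE ?a0 ?muln0.
by exists q; rewrite ?bE // mem_iota ltnS leq_pmulr.
Qed.

Lemma computable_prime {C : Type} {eC : encodable C} (p : C -> nat) :
  computable p -> computable (fun c => prime (p c)).
Proof.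
apply: (computable_comp (f := prime)).
have : computable (fun n => (1 < n) &&
    all (fun d => ~~ (d %| n) || ((d == 1) || (d == n))) (iota 0 n.+1)).
  by computability; apply: computable_dvdn; computability.
apply: eq_computable => n; apply/andP/primeP => -[n_gt1 dvdP]; split=> //.
  move=> d d_n; have d_le : d <= n by apply: dvdn_leq => //; exact: ltnW.
  by have := allP dvdP d; rewrite mem_iota ltnS d_le d_n; apply.
apply/allP=> d _; case d_n: (d %| n) => //=; exact: dvdP.
Qed.

Lemma size_filter_ltn l m : l <= m -> size [seq k <- iota 0 m | k < l] = l.
Proof.
move=> /subnKC <-; rewrite iotaD filter_cat size_cat add0n.
rewrite (@eq_in_filter _ _ predT) => [|k]; last by rewrite mem_iota.
rewrite filter_predT size_iota (@eq_in_filter _ _ pred0) => [|k].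
  by rewrite filter_pred0 addn0.
by rewrite mem_iota => /andP[le_lk _]; rewrite ltnNge le_lk.
Qed.

Lemma computable_logn {C : Type} {eC : encodable C} (p n : C -> nat) :
  (forall c, prime (p c)) -> computable p -> computable n ->
  computable (fun c => logn (p c) (n c)).
Proof.
move=> p_pr cp cn.
(* For nonzero [n c], the valuation counts the positive exponents [k.+1] such
   that the corresponding power of [p c] divides [n c]. *)
have : computable (fun c => if n c == 0 then 0 else
    size [seq k <- iota 0 (n c) | p c ^ k.+1 %| n c]).
  computability; apply: computable_dvdn; computability;
    [apply: (computable_comp cp) | apply: (computable_comp cn)]; computability.
apply: eq_computable => c; case: posnP => [->|n_gt0]; first by rewrite logn0.
rewrite (@eq_filter _ _ (fun k => k < logn (p c) (n c))); last first.
  by move=> k; rewrite pfactor_dvdn.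
by rewrite size_filter_ltn // ltnW // ltn_logl.
Qed.

(** * Prime factorisation codes of strings *)

Lemma next_primeP n :
  [/\ n < next_prime n, prime (next_prime n)
    & forall m, n < m -> prime m -> next_prime n <= m].
Proof.
rewrite /next_prime; case: ex_minnP => p /andP[lt_np p_pr] p_min; split=> // m.
by move=> lt_nm m_pr; apply: p_min; rewrite lt_nm.
Qed.

Lemma prime_nth_prime m : prime (nth_prime m).
Proof.
by case: m => // m; rewrite /nth_prime iterS; case: (next_primeP (iter m next_prime 2)).
Qed.

Lemma nth_prime_lt m n : m < n -> nth_prime m < nth_prime n.
Proof.
elim: n => // n IHn; rewrite ltnS leq_eqVlt => le_mn.
have ltS : nth_prime n < nth_prime n.+1.
  by rewrite /nth_prime iterS; case: (next_primeP (iter n next_prime 2)).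
by case/orP: le_mn => [/eqP ->|/IHn] //; move/ltn_trans; apply.
Qed.

Lemma nth_prime_inj : injective nth_prime.
Proof.
by move=> m n eq_p; case: (ltngtP m n) => // /nth_prime_lt; rewrite eq_p ltnn.
Qed.

Lemma computable_nth_prime {C : Type} {eC : encodable C} (m : C -> nat) :
  computable m -> computable (fun c => nth_prime (m c)).
Proof.
move=> cm; rewrite /nth_prime; computability.
suff r : rec1 next_prime by apply: (computable_rec1 r); computability.
have [g rg gE] : computable (fun p : nat * nat => (p.2 < p.1) && prime p.1).
  by computability; apply: computable_prime; computability.
have rb : rec2 (fun m p => (p < m) && prime m).
  apply: eq_recursive (recursive_rec1 rg rec2_npair) => v.
  exact: (gE (nth 0 v 0, nth 0 v 1)).
apply: (rec1_min rb) => [n|n k]; have [lt_n n_pr n_min] := next_primeP n.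
  by rewrite lt_n n_pr.
rewrite ltnNge; apply: contra => /andP[lt_nk k_pr]; exact: n_min.
Qed.

Lemma computable_string_code {C : Type} {eC : encodable C} (s : C -> seq nat) :
  computable s -> computable (fun c => string_code (s c)).
Proof.
apply: (computable_comp (f := string_code)).
have : computable (fun s => foldr muln 1
    [seq nth_prime m ^ nth 0 s m | m <- iota 0 (size s)]).
  by computability; apply: computable_nth_prime; computability.
apply: eq_computable => t; rewrite foldrE big_map /string_code.
by rewrite -(big_mkord xpredT (fun m => nth_prime m ^ nth 0 t m)) /index_iota subn0.
Qed.

(** The exponents of the successive primes in [c], without the zeros.  This
    inverts [string_code] on strings of positive numbers; the range of [m] is
    long enough since the code of a string is at least its length. *)
Definition decode_string (c : nat) : seq nat :=
  [seq e <- [seq logn (nth_prime m) c | m <- iota 0 c] | 0 < e].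

Lemma computable_decode_string : computable decode_string.
Proof.
rewrite /decode_string; computability.
apply: computable_logn; [by move=> c; exact: prime_nth_prime| |by computability].
by apply: computable_nth_prime; computability.
Qed.

Lemma logn_prod_nth_prime (a : nat -> nat) n k :
  logn (nth_prime k) (\prod_(m < n) nth_prime m ^ a m) = if k < n then a k else 0.
Proof.
have prod_gt0 j : 0 < \prod_(m < j) nth_prime m ^ a m.
  by rewrite prodn_gt0 // => i; rewrite expn_gt0 prime_gt0 ?prime_nth_prime.
elim: n => [|n IHn]; first by rewrite big_ord0 logn1.
rewrite big_ord_recr /= lognM ?prod_gt0 ?expn_gt0 ?(prime_gt0 (prime_nth_prime n)) //.
rewrite IHn lognX logn_prime ?prime_nth_prime // (inj_eq nth_prime_inj) ltnS.
by rewrite eq_sym; case: (ltngtP k n) => [||->]; rewrite ?muln0 ?muln1 ?addn0.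
Qed.

Lemma leq_prod_nth_prime (a : nat -> nat) n :
  (forall m, m < n -> 0 < a m) -> n <= \prod_(m < n) nth_prime m ^ a m.
Proof.
move=> a_gt0; suff : n < \prod_(m < n) nth_prime m ^ a m by exact: ltnW.
elim: n a_gt0 => [|n IHn] a_gt0; first by rewrite big_ord0.
rewrite big_ord_recr /=.
have lt_n : n < \prod_(m < n) nth_prime m ^ a m.
  by apply: IHn => m lt_mn; apply: a_gt0; exact: leqW.
have ge2 : 2 <= nth_prime n ^ a n.
  apply: leq_trans (prime_gt1 (prime_nth_prime n)) _.
  by rewrite -{1}[nth_prime n]expn1 leq_exp2l ?prime_gt1 ?prime_nth_prime ?a_gt0.
apply: leq_trans (leq_mul lt_n ge2); rewrite muln2 -addnn.
by rewrite -[X in X <= _]addn1 leq_add2l.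
Qed.

Lemma string_codeK s : all (leq 1) s -> decode_string (string_code s) = s.
Proof.
move=> /(all_nthP 0) s_gt0; rewrite /decode_string /string_code.
have /subnKC := leq_prod_nth_prime s_gt0.
set c := \prod_(_ < _) _ => cE.
rewrite -[X in iota 0 X]cE iotaD map_cat filter_cat add0n.
have lognc k : logn (nth_prime k) c = nth 0 s k.
  by rewrite logn_prod_nth_prime; case: ltnP => // /(nth_default 0) ->.
rewrite !(eq_map lognc).
rewrite (@eq_in_filter _ _ pred0 [seq nth 0 s m | m <- iota (size s) _]).
  rewrite filter_pred0 cats0 -/(mkseq _ _) mkseq_nth.
  by apply/all_filterP/(all_nthP 0).
by move=> _ /mapP[k + ->]; rewrite mem_iota => /andP[/(nth_default 0) -> _].
Qed.

(** * The translation of codes *)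

(** A system as a list of formulas, each given by the number of its relation
    and the strings of its arguments. *)
Notation raw_system := (seq (nat * seq (seq nat))).

(** A number [l] of auxiliary variables, paired with a raw system in some
    distinguished variables followed by [l] auxiliary ones. *)
Notation template := (nat * raw_system)%type.

(** Replaces the variable of index [i] by the one of index [nth 0 vs i].  A
    symbol is a variable exactly when its exponent of 3 is nonzero, and that
    exponent is the index plus one. *)
Definition rename_symbol (vs : seq nat) (s : nat) : nat :=
  if logn 3 s == 0 then s else 3 ^ (nth 0 vs (logn 3 s).-1).+1.

(** The codes of the formulas of a raw system after renaming its variables by
    [vs]. *)
Definition instance_code (vs : seq nat) (fs : raw_system) : seq (seq nat) :=
  [seq b.1 :: [seq string_code [seq rename_symbol vs s | s <- t] | t <- b.2]
  | b <- fs].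

(** The state of the translation is the first unused variable and the list of
    the codes of the formulas produced so far.  Using a template at the
    variables [ws] reserves its auxiliary variables. *)
Definition use_template (ws : seq nat) (q : template) (st : nat * seq (seq nat)) :
    nat * seq (seq nat) :=
  (st.1 + q.1, instance_code (ws ++ iota st.1 q.1) q.2 ++ st.2).

(** The arity and the template associated with a symbol or with the number of a
    relation; the default value plays no role on codes of systems. *)
Definition lookup (tab : seq (nat * (nat * template))) (key : nat) :
    nat * template :=
  foldr (fun e r => if e.1 == key then e.2 else r) (0, (0, [::])) tab.

(** One step of the stack machine.  A variable is pushed; any other symbol pops
    its arguments, reserves a variable for its value, which it pushes, and uses
    its template at the arguments followed by the value. *)
Definition read_symbol tab (s : nat) (st : seq nat * (nat * seq (seq nat))) :
    seq nat * (nat * seq (seq nat)) :=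
  if logn 3 s == 0 then
    (st.2.1 :: drop (lookup tab s).1 st.1,
     use_template (rcons (take (lookup tab s).1 st.1) st.2.1) (lookup tab s).2
       (st.2.1.+1, st.2.2))
  else ((logn 3 s).-1 :: st.1, st.2).

(** Since [foldr] reads from the right, the values of the terms end up on the
    stack in the order of the terms. *)
Definition read_terms tab (ts : seq (seq nat)) (st : nat * seq (seq nat)) :
    seq nat * (nat * seq (seq nat)) :=
  foldr (read_symbol tab) ([::], st) (flatten ts).

Definition read_formula tab reltab (b : nat * seq (seq nat))
    (st : nat * seq (seq nat)) : nat * seq (seq nat) :=
  use_template (read_terms tab b.2 st).1 (lookup reltab b.1).2
    (read_terms tab b.2 st).2.

(** The translation of a system in [n] variables; [dom] is the template of the
    image of the whole structure. *)
Definition read_system tab reltab dom (n : nat) (fs : raw_system) :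
    nat * seq (seq nat) :=
  foldr (fun i => use_template [:: i] dom)
    (foldr (read_formula tab reltab) (n, [::]) fs) (iota 0 n).

(** Recovers a system from its code: the first entry is the number of formulas,
    and the number of a relation gives that of the terms which follow it. *)
Definition parse_system reltab (c : seq nat) : raw_system :=
  rev (iter (head 0 c) (fun q : raw_system * seq nat =>
    ((head 0 q.2,
      [seq decode_string t
      | t <- take (lookup reltab (head 0 q.2)).1 (behead q.2)]) :: q.1,
     drop (lookup reltab (head 0 q.2)).1 (behead q.2))) ([::], behead c)).1.

(** The index plus one of the last variable that occurs in a raw system, or 0 if
    there is none. *)
Definition last_index (fs : raw_system) : nat :=
  foldr maxn 0 [seq logn 3 s | s <- flatten (flatten [seq b.2 | b <- fs])].

(** The code of a system from those of its formulas. *)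
Definition join_code (fs : seq (seq nat)) : seq nat := size fs :: flatten fs.

Definition translate tab reltab dom (c : seq nat) : seq nat :=
  join_code
    (read_system tab reltab dom (last_index (parse_system reltab c))
      (parse_system reltab c)).2.

Lemma computable_logn3 {C : Type} {eC : encodable C} (n : C -> nat) :
  computable n -> computable (fun c => logn 3 (n c)).
Proof. by move=> cn; apply: computable_logn => //; exact: computable_cst. Qed.

Lemma computable_rename_symbol {C : Type} {eC : encodable C} vs (s : C -> nat) :
  computable vs -> computable s -> computable (fun c => rename_symbol (vs c) (s c)).
Proof.
by move=> cvs cs; rewrite /rename_symbol; computability; apply: computable_logn3.
Qed.

Lemma computable_use_template {C : Type} {eC : encodable C} ws q st :
  computable ws -> computable q -> computable st ->
  computable (fun c : C => use_template (ws c) (q c) (st c)).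
Proof.
move=> cws cq cst; rewrite /use_template /instance_code; computability.
apply: computable_string_code; computability.
apply: computable_rename_symbol; computability;
  [apply: (computable_comp cws) | apply: (computable_comp cst)
  | apply: (computable_comp cq)]; computability.
Qed.

Lemma computable_lookup {C : Type} {eC : encodable C} tab (key : C -> nat) :
  computable key -> computable (fun c => lookup tab (key c)).
Proof.
move=> ck; rewrite /lookup; computability.
by apply: (computable_comp ck); computability.
Qed.

Lemma computable_rcons {C A : Type} {eC : encodable C} {eA : encodable A}
    s (x : C -> A) :
  computable s -> computable x -> computable (fun c => rcons (s c) (x c)).
Proof.
move=> cs cx; have : computable (fun c => s c ++ [:: x c]) by computability.
by apply: eq_computable => c; rewrite cats1.
Qed.

Lemma computable_read_terms {C : Type} {eC : encodable C} tab ts st :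
  computable ts -> computable st ->
  computable (fun c : C => read_terms tab (ts c) (st c)).
Proof.
move=> cts cst; rewrite /read_terms; computability.
rewrite /read_symbol; computability; try by apply: computable_logn3; computability.
all: try by apply: computable_lookup; computability.
apply: computable_use_template; computability; last first.
  by apply: computable_lookup; computability.
by apply: computable_rcons; computability; apply: computable_lookup; computability.
Qed.

Lemma computable_read_system {C : Type} {eC : encodable C} tab reltab dom n fs :
  computable n -> computable fs ->
  computable (fun c : C => read_system tab reltab dom (n c) (fs c)).
Proof.
move=> cn cfs; rewrite /read_system; computability.
  by apply: computable_use_template; computability.
rewrite /read_formula; apply: computable_use_template; computability;
  try by apply: computable_read_terms; computability.
by apply: computable_lookup; computability.
Qed.

Lemma computable_parse_system reltab : computable (parse_system reltab).
Proof.
rewrite /parse_system; computability; try by apply: computable_lookup; computability.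
by apply: (computable_comp computable_decode_string); computability.
Qed.

Lemma computable_last_index : computable last_index.
Proof.
rewrite /last_index; computability; last by apply: computable_logn3; computability.
by rewrite /maxn; computability.
Qed.

Lemma computable_translate tab reltab dom : computable (translate tab reltab dom).
Proof.
rewrite /translate /join_code; computability; apply: computable_read_system;
  try exact: computable_parse_system.
all: by apply: (computable_comp computable_last_index); exact: computable_parse_system.
Qed.

Lemma computable_recursive_seq (D : seq nat -> seq nat) :
  computable D -> recursive_seq D.
Proof.
move=> [g rg gE]; exists (fun v => g (nth 0 v 0)) => // s; exact: gE.
Qed.

(** * Renaming variables and reading codes *)

Section Rename.
Context {R : Type} {L : language R} (N : numbering L).

Fixpoint rename_term m n (r : 'I_m -> 'I_n) (t : term L m) : term L n :=
  match t with
  | Var i => Var (r i)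
  | Cst c => Cst c
  | App f ts => App (fun i => rename_term r (ts i))
  end.

Definition rename_formula m n (r : 'I_m -> 'I_n) (b : basic_formula L m) :
    basic_formula L n :=
  BasicFormula (fun i : 'I_(relar (brel b)) => rename_term r (bargs i)).

Definition rename_system m n (r : 'I_m -> 'I_n) (T : system L m) : system L n :=
  [seq rename_formula r b | b <- T].

Definition raw_formula n (b : basic_formula L n) : nat * seq (seq nat) :=
  (relnum N (brel b),
   [seq term_string N (bargs (b := b) i) | i <- enum 'I_(relar (brel b))]).

(** The raw system that represents a system. *)
Definition raw n (T : system L n) : raw_system := [seq raw_formula b | b <- T].

Lemma eval_rename m n (r : 'I_m -> 'I_n) (x : n.-tuple R) (t : term L m) :
  eval x (rename_term r t) = eval [tuple tnth x (r i) | i < m] t.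
Proof.
elim: t => [i|c|f ts IHts] //=; first by rewrite tnth_mktuple.
by congr fint; apply: eq_from_tnth => i; rewrite !tnth_mktuple.
Qed.

Lemma holds_rename m n (r : 'I_m -> 'I_n) (x : n.-tuple R) (b : basic_formula L m) :
  holds x (rename_formula r b) = holds [tuple tnth x (r i) | i < m] b.
Proof.
rewrite /holds; congr (relint _ _); apply: eq_from_tnth => i.
by rewrite !tnth_mktuple eval_rename.
Qed.

Lemma solution_rename m n (r : 'I_m -> 'I_n) (x : n.-tuple R) (T : system L m) :
  solution x (rename_system r T) = solution [tuple tnth x (r i) | i < m] T.
Proof. by elim: T => //= b T ->; rewrite holds_rename. Qed.

Lemma solution_cat n (x : n.-tuple R) (T1 T2 : system L n) :
  solution x (T1 ++ T2) <-> solution x T1 /\ solution x T2.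
Proof. by elim: T1 => [|b T1 IHT1] /=; tauto. Qed.

Lemma logn3_exp2 k : logn 3 (2 ^ k) = 0.
Proof. by rewrite lognX logn_prime ?muln0. Qed.

Lemma term_string_rename m n (r : 'I_m -> 'I_n) vs (t : term L m) :
  (forall i, r i = nth 0 vs i :> nat) ->
  term_string N (rename_term r t) = [seq rename_symbol vs s | s <- term_string N t].
Proof.
move=> rE; elim: t => [i|c|f ts IHts] /=.
- by rewrite /rename_symbol pfactorK // rE.
- by rewrite /rename_symbol logn3_exp2.
rewrite /rename_symbol logn3_exp2 /= -/(rename_symbol vs) map_flatten -map_comp.
by congr (_ :: flatten _); apply: eq_map => i /=; exact: IHts.
Qed.

Lemma rename_system_code m n (r : 'I_m -> 'I_n) vs (T : system L m) :
  (forall i, r i = nth 0 vs i :> nat) ->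
  [seq formula_code N b | b <- rename_system r T] = instance_code vs (raw T).
Proof.
move=> rE; rewrite -map_comp /instance_code -map_comp; apply: eq_map => b /=.
rewrite /formula_code /=; congr (_ :: _); rewrite -map_comp.
by apply: eq_map => i /=; rewrite /term_code (term_string_rename _ rE).
Qed.

Lemma term_string_gt0 n (t : term L n) : all (leq 1) (term_string N t).
Proof.
elim: t => [i|c|f ts IHts] /=; rewrite ?expn_gt0 //.
apply/allP => s /flattenP[_ /mapP[i _ ->]]; exact/allP.
Qed.

Lemma raw_parse n (T : system L n) reltab :
  (forall S : relation L, (lookup reltab (relnum N S)).1 = relar S) ->
  parse_system reltab (system_code N T) = raw T.
Proof.
move=> tabE; rewrite /parse_system /system_code /=.
set step := (X in iter _ X).
suff iterE acc : iter (size T) step (acc, flatten [seq formula_code N b | b <- T]) =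
    (rev (raw T) ++ acc, [::]).
  by rewrite iterE cats0 revK.
elim: T acc => // b T IHT acc; rewrite [size _]/= iterSr.
have -> : step (acc, flatten [seq formula_code N b | b <- b :: T]) =
    (raw_formula b :: acc, flatten [seq formula_code N b | b <- T]).
  have sz : size [seq term_code N (bargs (b := b) i) | i <- enum 'I_(relar (brel b))] =
      relar (brel b) by rewrite size_map size_enum_ord.
  rewrite /step /= tabE take_size_cat // drop_size_cat // -map_comp.
  congr ((_, _) :: _, _); apply: eq_map => i /=.
  exact/string_codeK/term_string_gt0.
by rewrite IHT /= rev_cons cat_rcons.
Qed.

Lemma last_index_raw n (T : system L n) : last_index (raw T) = last_var T.
Proof.
have termE (t : term L n) :
    \max_(s <- term_string N t) logn 3 s = \max_(i <- term_vars t) i.+1.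
  elim: t => [i|c|f ts IHts] /=.
  - by rewrite !big_seq1 pfactorK.
  - by rewrite big_seq1 logn3_exp2 big_nil.
  rewrite big_cons logn3_exp2 max0n !big_flatten !big_map.
  by apply: eq_bigr => i _; exact: IHts.
rewrite /last_index foldrE big_map !big_flatten /= !big_map /last_var.
rewrite /system_vars big_flatten big_map; apply: eq_bigr => b _.
rewrite big_map big_flatten big_map; apply: eq_bigr => i _; exact: termE.
Qed.

End Rename.

(** * Instances of systems *)

Section Instances.
Context {R : Type} {L : language R} (N : numbering L).

(** In what follows assignments of values to variables are functions [e] on
    all indices; this is the tuple of the values of the variables [vs]. *)
Definition env_tuple (e : nat -> R) (vs : seq nat) k : k.-tuple R :=
  [tuple e (nth 0 vs i) | i < k].

Lemma val_env_tuple e vs k : size vs = k -> env_tuple e vs k = map e vs :> seq R.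
Proof.
move=> vsk; apply: (@eq_from_nth _ (e 0)) => [|i]; rewrite size_tuple ?size_map //.
move=> lt_ik; rewrite (nth_map 0) ?vsk //.
exact: (nth_mktuple (fun i : 'I_k => e (nth 0 vs i)) (e 0) (Ordinal lt_ik)).
Qed.

(** A system together with the variables at which it is used, so that systems in
    different numbers of variables can be collected in one list. *)
Record instance := Instance {
  inst_arity : nat;
  inst_system : system L inst_arity;
  inst_vars : seq nat }.

(** The variables of [J] are of the right number and have index below [m]. *)
Definition bounded m (J : instance) : bool :=
  (size (inst_vars J) == inst_arity J) && all (fun k => k < m) (inst_vars J).

Definition inst_holds (e : nat -> R) (J : instance) : Prop :=
  solution (env_tuple e (inst_vars J) (inst_arity J)) (inst_system J).

Definition inst_code (J : instance) : seq (seq nat) :=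
  instance_code (inst_vars J) (raw N (inst_system J)).

Fixpoint all_hold (e : nat -> R) (Js : seq instance) : Prop :=
  if Js is J :: Js' then inst_holds e J /\ all_hold e Js' else True.

(** The codes of all formulas of a list of instances. *)
Definition codes (Js : seq instance) : seq (seq nat) :=
  flatten [seq inst_code J | J <- Js].

Lemma all_hold_cat e Js Js' :
  all_hold e (Js ++ Js') <-> all_hold e Js /\ all_hold e Js'.
Proof. by elim: Js => [|J Js IHJs] /=; tauto. Qed.

(** [e] and [e'] take the same values below [m]. *)
Definition agree m (e e' : nat -> R) := forall k, k < m -> e' k = e k.

Lemma agree_trans m1 m2 e1 e2 e3 :
  m1 <= m2 -> agree m1 e1 e2 -> agree m2 e2 e3 -> agree m1 e1 e3.
Proof. by move=> le_m e12 e23 k ltk; rewrite e23 ?e12 // (leq_trans ltk). Qed.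

Lemma inst_holds_agree m e e' J :
  bounded m J -> agree m e e' -> inst_holds e J -> inst_holds e' J.
Proof.
move=> /andP[/eqP szJ /allP ltJ] ee'; rewrite /inst_holds.
suff -> : env_tuple e' (inst_vars J) (inst_arity J) =
          env_tuple e (inst_vars J) (inst_arity J) by [].
apply: eq_from_tnth => i; rewrite !tnth_mktuple ee' //.
by apply: ltJ; rewrite mem_nth // szJ; exact: ltn_ord.
Qed.

Lemma all_hold_agree m e e' Js :
  all (bounded m) Js -> agree m e e' -> all_hold e Js -> all_hold e' Js.
Proof.
move=> + ee'; elim: Js => //= J Js IHJs /andP[bJ bJs] [eJ eJs].
by split; [exact: inst_holds_agree bJ ee' eJ | exact: IHJs].
Qed.

Lemma bounded_leq m m' J : m <= m' -> bounded m J -> bounded m' J.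
Proof.
move=> le_m /andP[szJ /allP ltJ]; rewrite /bounded szJ; apply/allP => k /ltJ lt_k.
exact: leq_trans lt_k le_m.
Qed.

(** A list of instances as a single system in [n] variables.  The default value
    of [insubd] is irrelevant when the instances are bounded by [n]. *)
Definition flat_system n (n_gt0 : 0 < n) (Js : seq instance) : system L n :=
  flatten [seq rename_system
    (fun i : 'I_(inst_arity J) =>
       insubd (Ordinal n_gt0) (nth 0 (inst_vars J) i)) (inst_system J) | J <- Js].

Lemma bounded_var n (n_gt0 : 0 < n) J (i : 'I_(inst_arity J)) :
  bounded n J ->
  insubd (Ordinal n_gt0) (nth 0 (inst_vars J) i) = nth 0 (inst_vars J) i :> nat.
Proof.
move=> /andP[/eqP szJ /allP ltJ]; rewrite val_insubd ifT //.
by apply: ltJ; rewrite mem_nth // szJ; exact: ltn_ord.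
Qed.

Lemma solution_flat_system n (n_gt0 : 0 < n) Js (v : n.-tuple R) (e : nat -> R) :
  all (bounded n) Js -> (forall i : 'I_n, e i = tnth v i) ->
  solution v (flat_system n_gt0 Js) <-> all_hold e Js.
Proof.
move=> + ve; elim: Js => //= J Js IHJs /andP[bJ /IHJs <-].
rewrite solution_cat solution_rename /inst_holds.
suff -> : [tuple tnth v (insubd (Ordinal n_gt0) (nth 0 (inst_vars J) i))
          | i < inst_arity J] = env_tuple e (inst_vars J) (inst_arity J) by [].
by apply: eq_from_tnth => i; rewrite !tnth_mktuple -ve bounded_var.
Qed.

Lemma flat_system_code n (n_gt0 : 0 < n) Js :
  all (bounded n) Js ->
  system_code N (flat_system n_gt0 Js) = join_code (codes Js).
Proof.
move=> bJs; rewrite /system_code /join_code.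
suff -> : [seq formula_code N b | b <- flat_system n_gt0 Js] = codes Js.
  suff -> : size (flat_system n_gt0 Js) = size (codes Js) by [].
  elim: Js bJs => //= J Js IHJs /andP[_ /IHJs]; rewrite /codes /= !size_cat => ->.
  by rewrite /inst_code /instance_code !size_map.
elim: Js bJs => //= J Js IHJs /andP[bJ /IHJs]; rewrite /codes /= map_cat => ->.
by congr (_ ++ _); apply: rename_system_code => i; exact: bounded_var.
Qed.

(** The template [q] describes the set [S]. *)
Definition represents k (S : set (k.-tuple R)) (q : template) : Prop :=
  exists l (T : system L (k + l)), q = (l, raw N T) /\
    S = [set x : k.-tuple R |
          exists y : l.-tuple R, solution [tuple of x ++ y] T].

Lemma diophantine_represents k (S : set (k.-tuple R)) :
  diophantine L S -> exists q, represents S q.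
Proof. by move=> [l [T ->]]; exists (l, raw N T), l, T. Qed.

(** Using a template for [S] produces an instance [J] which forces the values of
    the variables [ws] to form an element of [S], and which can be satisfied by
    changing only the variables from [m] on whenever they do form one. *)
Lemma use_template_spec k (S : set (k.-tuple R)) q ws m out :
  represents S q -> size ws = k -> all (fun k => k < m) ws ->
  exists J m', [/\ use_template ws q (m, out) = (m', inst_code J ++ out),
    m <= m', bounded m' J,
    forall e, inst_holds e J -> S (env_tuple e ws k)
    & forall e, S (env_tuple e ws k) ->
      exists2 e', agree m e e' & inst_holds e' J].
Proof.
move=> [l [T [-> ->]]] szw ltw.
have envE e : env_tuple e (ws ++ iota m l) (k + l) =
    [tuple of env_tuple e ws k ++ [tuple e (m + i) | i < l]].
  apply: val_inj => /=; rewrite !val_env_tuple ?size_cat ?size_iota ?szw //.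
  rewrite map_cat; congr (_ ++ _); rewrite -[m in iota m l]addn0 iotaDl -map_comp.
  rewrite -val_enum_ord -map_comp; exact: eq_map.
exists (Instance T (ws ++ iota m l)), (m + l); split=> //.
- exact: leq_addr.
- rewrite /bounded /= size_cat size_iota szw eqxx all_cat /=; apply/andP; split.
    by apply/allP => i /(allP ltw) /= lt_im; exact: leq_trans lt_im (leq_addr _ _).
  by apply/allP => i; rewrite mem_iota => /andP[].
- move=> e; rewrite /inst_holds /= envE => Te.
  by exists [tuple e (m + i) | i < l].
move=> e [y Ty]; pose e' i := if i < m then e i else nth (e 0) y (i - m).
have e'e : agree m e e' by rewrite /agree /e' => i ->.
exists e' => //; rewrite /inst_holds /= envE.
have -> : env_tuple e' ws k = env_tuple e ws k.
  apply: eq_from_tnth => i; rewrite !tnth_mktuple e'e //.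
  by apply: (allP ltw); rewrite mem_nth // szw.
suff -> : [tuple e' (m + i) | i < l] = y by [].
apply: eq_from_tnth => i; rewrite tnth_mktuple /e' ltnNge leq_addr /= addKn.
by rewrite (tnth_nth (e 0)).
Qed.

End Instances.
Arguments instance {R} L.

(** * Correctness of the translation *)

Section Translation.
Context {R1 R2 : Type} {L1 : language R1} {L2 : language R2}.
Context (N1 : numbering L1) (N2 : numbering L2).
Context (d : R1 -> R2) (d_inj : injective d).

(** Constants are treated together with functions, as symbols of arity 0. *)
Definition symbol := (cst_sym L1 + fun_sym L1)%type.

Definition sym_arity (s : symbol) : nat := if s is inr f then far f else 0.

Definition sym_int (s : symbol) : (sym_arity s).-tuple R1 -> R1 :=
  match s with inl c => fun=> cint c | inr f => fint f end.

(** The image by [d] of the graph of a symbol. *)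
Definition sym_graph (s : symbol) : set ((sym_arity s).+1.-tuple R2) :=
  [set [tuple of rcons (map_tuple d x) (d (sym_int x))]
    | x in [set: (sym_arity s).-tuple R1]].

(** Tables of the templates for the graphs of the symbols and for the relations,
    and the template for the image of [d]. *)
Context (tab reltab : seq (nat * (nat * template))) (dom : template).

Context (tab_ok : forall s : symbol,
  (lookup tab (2 ^ num N1 s)).1 = sym_arity s /\
  represents N2 (sym_graph (s := s)) (lookup tab (2 ^ num N1 s)).2).
Context (reltab_ok : forall S : relation L1,
  (lookup reltab (relnum N1 S)).1 = relar S /\
  represents N2 (imaget d (relint S)) (lookup reltab (relnum N1 S)).2).
Context (dom_ok : represents N2 [set [tuple d x] | x in [set: R1]] dom).

Context (n : nat).

(** The first [n] variables take the values [d x]. *)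
Definition encodes (x : n.-tuple R1) (e : nat -> R2) :=
  forall i : 'I_n, e i = d (tnth x i).

Lemma encodes_agree m x e e' : n <= m -> agree m e e' -> encodes x e -> encodes x e'.
Proof.
move=> le_nm ee' xe i; rewrite ee' //; exact: leq_trans (ltn_ord i) le_nm.
Qed.

(** The instances [Js] are bounded by [m'] and, whenever [e] encodes a tuple that
    satisfies [G], can be satisfied without changing [e] below [m]. *)
Definition extends (G : n.-tuple R1 -> Prop) m m' (Js : seq (instance L2)) :=
  [/\ m <= m', all (bounded m') Js
    & forall x e, encodes x e -> G x -> exists2 e', agree m e e' & all_hold e' Js].

Lemma extends_nil G m : extends G m m [::].
Proof. by split=> // x e _ _; exists e. Qed.

Lemma extends_weaken (G G' : n.-tuple R1 -> Prop) m m' Js :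
  (forall x, G' x -> G x) -> extends G m m' Js -> extends G' m m' Js.
Proof. by move=> GG' [? ? h]; split=> // x e xe /GG'; exact: h. Qed.

Lemma extends_comp G m m1 m2 Js1 Js2 :
  n <= m -> extends G m m1 Js1 -> m1 <= m2 -> all (bounded m2) Js2 ->
  (forall x e, encodes x e -> all_hold e Js1 -> G x ->
     exists2 e', agree m1 e e' & all_hold e' Js2) ->
  extends G m m2 (Js2 ++ Js1).
Proof.
move=> le_nm [le_m b1 ext1] le_m1 b2 ext2; split=> [||x e xe Gx].
- exact: leq_trans le_m1.
- rewrite all_cat b2; apply: sub_all b1 => J; exact: bounded_leq.
have [e1 ee1 h1] := ext1 x e xe Gx.
have [e2 ee2 h2] := ext2 x e1 (encodes_agree le_nm ee1 xe) h1 Gx.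
exists e2; first exact: agree_trans ee1 ee2.
by apply/all_hold_cat; split=> //; exact: all_hold_agree ee2 h1.
Qed.

Lemma codes_cat (Js Js' : seq (instance L2)) out :
  codes N2 (Js ++ Js') ++ out = codes N2 Js ++ (codes N2 Js' ++ out).
Proof. by rewrite /codes map_cat flatten_cat catA. Qed.

(** If the arguments of the symbol [s] are on top of the stack and take the
    values [d (args x)], then the value pushed is [d] of the value of [s]. *)
Lemma read_symbol_spec (s : symbol) (args : n.-tuple R1 -> (sym_arity s).-tuple R1)
    G m m1 Js ws stk out :
  n <= m -> extends G m m1 Js -> size ws = sym_arity s ->
  all (fun k => k < m1) ws ->
  (forall x e, encodes x e -> all_hold e Js -> map e ws = map d (args x)) ->
  exists m' J,
    [/\ read_symbol tab (2 ^ num N1 s) (ws ++ stk, (m1, codes N2 Js ++ out)) =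
          (m1 :: stk, (m', codes N2 (J :: Js) ++ out)),
        m1 < m', extends G m m' (J :: Js)
      & forall x e, encodes x e -> all_hold e (J :: Js) ->
          e m1 = d (sym_int (args x))].
Proof.
move=> le_nm ext szw ltw wsE; have [arE repr] := tab_ok s.
have szw' : size (rcons ws m1) = (sym_arity s).+1 by rewrite size_rcons szw.
have ltw' : all (fun k => k < m1.+1) (rcons ws m1).
  by rewrite all_rcons ltnSn; apply: sub_all ltw => k; exact: leqW.
have [J [m' [runE le_m' bJ sound complete]]] :=
  use_template_spec (codes N2 Js ++ out) repr szw' ltw'.
have envE e :
    env_tuple e (rcons ws m1) (sym_arity s).+1 = rcons (map e ws) (e m1) :> seq R2.
  by rewrite val_env_tuple // map_rcons.
exists m', J; split=> //.
- rewrite /read_symbol logn3_exp2 eqxx arE.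
  by rewrite -szw take_size_cat // drop_size_cat // runE /codes /= catA.
- apply: (extends_comp (Js2 := [:: J])) ext _ _ _ => //=.
  + exact: ltnW.
  + by rewrite bJ.
  move=> x e xe eJs _.
  (* First assign the variable [m1] of the value, then the auxiliary ones. *)
  pose e1 k := if k == m1 then d (sym_int (args x)) else e k.
  have ee1 : agree m1 e e1 by move=> k lt_k; rewrite /e1 ltn_eqF.
  have [e2 e12 h2] : exists2 e2, agree m1.+1 e1 e2 & inst_holds e2 J.
    apply: complete; exists (args x) => //; apply: val_inj.
    apply/esym/(etrans (envE _)); rewrite /= -(wsE x e) // /e1 eqxx; congr rcons.
    by apply/eq_in_map => k /(allP ltw) lt_k; rewrite ltn_eqF.
  exists e2 => //; apply: agree_trans ee1 e12; exact: leqnSn.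
move=> x e xe [/sound[y _ yE] eJs].
move: yE => /(congr1 (@tval _ _)); rewrite envE /= => /rcons_inj[yE <-].
congr (d (sym_int _)); apply/val_inj/(inj_map d_inj).
by rewrite yE (wsE x e).
Qed.

(** Reading [t] pushes a variable [w] and produces instances which force [w] to
    take the value [d (eval x t)]. *)
Definition term_spec (t : term L1 n) := forall m stk out, n <= m ->
  exists w m' Js,
  [/\ foldr (read_symbol tab) (stk, (m, out)) (term_string N1 t) =
        (w :: stk, (m', codes N2 Js ++ out)),
      w < m', extends (fun=> True) m m' Js
    & forall x e, encodes x e -> all_hold e Js -> e w = d (eval x t)].

Lemma read_args_spec (I : Type) (s : seq I) (ts : I -> term L1 n) :
  (forall i, term_spec (ts i)) -> forall m stk out, n <= m ->
  exists ws m' Js,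
  [/\ foldr (read_symbol tab) (stk, (m, out))
        (flatten [seq term_string N1 (ts i) | i <- s]) =
        (ws ++ stk, (m', codes N2 Js ++ out)),
      size ws = size s /\ all (fun k => k < m') ws,
      extends (fun=> True) m m' Js
    & forall x e, encodes x e -> all_hold e Js ->
        map e ws = map d [seq eval x (ts i) | i <- s]].
Proof.
move=> tsP m stk out le_nm; elim: s => [|i s [ws [m1 [Js [runE [szw ltw] ext wsE]]]]].
  by exists [::], m, [::]; split=> //; exact: extends_nil.
have [le_m1 bJs _] := ext; have le_nm1 := leq_trans le_nm le_m1.
have [w [m' [Js' [runE' ltw' ext' wE]]]] :=
  tsP i m1 (ws ++ stk) (codes N2 Js ++ out) le_nm1.
have [le_m' bJs' compl'] := ext'.
exists (w :: ws), m', (Js' ++ Js); split.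
- by rewrite /= foldr_cat runE runE' codes_cat.
- rewrite /= szw ltw'; split=> //; apply: sub_all ltw => k lt_k.
  exact: leq_trans lt_k le_m'.
- by apply: extends_comp ext _ _ _ => // x e xe _; exact: compl'.
move=> x e xe /all_hold_cat[h' h] /=.
by rewrite (wE x e) // (wsE x e).
Qed.

Lemma read_term_spec t : term_spec t.
Proof.
elim: t => [i|c|f ts IHts] m stk out le_nm.
- exists (val i), m, [::]; split=> //.
  + by rewrite /= /read_symbol pfactorK.
  + exact: leq_trans (ltn_ord i) le_nm.
  + exact: extends_nil.
  + by move=> x e xe _; exact: xe.
- have [] := @read_symbol_spec (inl c) (fun=> [tuple]) (fun=> True) m m [::] [::]
    stk out le_nm (extends_nil _ _) erefl isT.
    by [].
  move=> m' [J [runE lt_m ext cE]]; exists m, m', [:: J]; split=> //.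
have [ws [m1 [Js [runE [szw ltw] ext wsE]]]] :=
  read_args_spec (enum 'I_(far f)) IHts stk out le_nm.
rewrite size_enum_ord in szw.
have [] := @read_symbol_spec (inr f) (fun x => [tuple eval x (ts i) | i < far f])
    (fun=> True) m m1 Js ws stk out le_nm ext szw ltw.
  by move=> x e xe /(wsE x e xe) ->.
move=> m' [J [runE' lt_m ext' cE]]; exists m1, m', (J :: Js); split=> //.
by rewrite /= runE.
Qed.

Lemma read_formula_spec (b : basic_formula L1 n) m out : n <= m ->
  exists m' Js,
  [/\ read_formula tab reltab (raw_formula N1 b) (m, out) = (m', codes N2 Js ++ out),
      extends (fun x => holds x b) m m' Js
    & forall x e, encodes x e -> all_hold e Js -> holds x b].
Proof.
move=> le_nm; have [arE repr] := reltab_ok (brel b).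
have [ws [m1 [Js [runE [szw ltw] ext wsE]]]] :=
  read_args_spec (enum 'I_(relar (brel b))) (fun i => read_term_spec (bargs i))
    [::] out le_nm.
rewrite size_enum_ord in szw; rewrite cats0 in runE.
have [J [m' [runE' le_m' bJ sound complete]]] :=
  use_template_spec (codes N2 Js ++ out) repr szw ltw.
exists m', (J :: Js); split.
- by rewrite /read_formula /read_terms /= runE /= runE' /codes /= catA.
- apply: (extends_comp (Js2 := [:: J]) le_nm (extends_weaken _ ext)) => //=.
  + by rewrite bJ.
  move=> x e xe eJs xb; have [|e' ee' h'] := complete e; last by exists e'.
  exists [tuple eval x (bargs i) | i < relar (brel b)] => //; apply: val_inj.
  by apply/esym/(etrans (val_env_tuple _ szw)); rewrite (wsE x e).
move=> x e xe [/sound[y Sy yE] eJs].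
rewrite /holds; suff -> : [tuple eval x (bargs i) | i < relar (brel b)] = y by [].
apply/val_inj/(inj_map d_inj); rewrite -(wsE x e) //.
by move/(congr1 (@tval _ _)): yE; rewrite val_env_tuple.
Qed.

Lemma read_formulas_spec (T : system L1 n) m out : n <= m ->
  exists m' Js,
  [/\ foldr (read_formula tab reltab) (m, out) (raw N1 T) = (m', codes N2 Js ++ out),
      extends (fun x => solution x T) m m' Js
    & forall x e, encodes x e -> all_hold e Js -> solution x T].
Proof.
move=> le_nm; elim: T => [|b T [m1 [Js [runE ext sound]]]].
  by exists m, [::]; split=> //; exact: extends_nil.
have [le_m1 bJs _] := ext; have le_nm1 := leq_trans le_nm le_m1.
have [m' [Js' [runE' ext' sound']]] :=
  read_formula_spec b (codes N2 Js ++ out) le_nm1.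
have [le_m' bJs' compl'] := ext'.
exists m', (Js' ++ Js); split.
- by rewrite /= runE runE' codes_cat.
- apply: (extends_comp le_nm (extends_weaken _ ext)) => //= [x []//|].
  by move=> x e xe _ [xb _]; exact: compl'.
move=> x e xe /all_hold_cat[h' h]; split; [exact: sound' h' | exact: sound h].
Qed.

(** The instances for the variables [s] are satisfied only if the values of these
    are in the image of [d]. *)
Lemma use_dom_spec s m out : n <= m -> all (fun k => k < n) s ->
  exists m' Js,
  [/\ foldr (fun i => use_template [:: i] dom) (m, out) s = (m', codes N2 Js ++ out),
      extends (fun=> True) m m' Js
    & forall e, all_hold e Js -> forall i, i \in s -> exists a, e i = d a].
Proof.
move=> le_nm; elim: s => [|i s IHs] /=.
  by exists m, [::]; split=> //; exact: extends_nil.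
move=> /andP[lt_in /IHs[m1 [Js [runE ext sound]]]].
have [le_m1 bJs _] := ext; have le_nm1 := leq_trans le_nm le_m1.
have lti : all (fun k => k < m1) [:: i] by rewrite /= (leq_trans lt_in).
have [J [m' [runE' le_m' bJ sound' complete]]] :=
  use_template_spec (codes N2 Js ++ out) dom_ok (erefl (size [:: i])) lti.
exists m', (J :: Js); split.
- by rewrite runE runE' /codes /= catA.
- apply: (extends_comp (Js2 := [:: J]) le_nm ext) => //=; first by rewrite bJ.
  move=> x e xe _ _; have [|e' ee' h'] := complete e; last by exists e'.
  exists (tnth x (Ordinal lt_in)) => //; apply: val_inj.
  by rewrite /= enum_ordSl enum_ord0 /= -(xe (Ordinal lt_in)).
move=> e [/sound'[a _ aE] eJs] k; rewrite inE => /orP[/eqP ->|]; last exact: sound.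
by exists a; move/(congr1 (@tval _ _)): aE; rewrite val_env_tuple //= => -[].
Qed.

(** The produced instances can be satisfied above the encoding of any solution
    of [T], and only above such encodings. *)
Lemma read_system_spec (T : system L1 n) :
  exists m Js,
  [/\ read_system tab reltab dom n (raw N1 T) = (m, codes N2 Js),
      n <= m /\ all (bounded m) Js,
      forall x, solution x T -> exists2 e, encodes x e & all_hold e Js
    & forall e, all_hold e Js -> exists2 x, encodes x e & solution x T].
Proof.
have [m1 [Js1 [run1 ext1 sound1]]] := read_formulas_spec T [::] (leqnn n).
have [le_m1 _ _] := ext1.
have iota_lt : all (fun k => k < n) (iota 0 n).
  by apply/allP => k; rewrite mem_iota.
have [m2 [Js2 [run2 ext2 sound2]]] :=
  use_dom_spec (codes N2 Js1 ++ [::]) le_m1 iota_lt.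
have [le_m2 b2 compl2] := ext2.
have [le_m b compl] : extends (fun x => solution x T) n m2 (Js2 ++ Js1).
  by apply: extends_comp ext1 _ _ _ => // x e xe _ _; exact: compl2.
exists m2, (Js2 ++ Js1); split=> //.
- by rewrite /read_system run1 run2 -codes_cat cats0.
- (* The values beyond the first [n] variables are arbitrary. *)
  move=> x Tx; pose e0 k := nth (d (cint (czero L1))) (map d x) k.
  have xe0 : encodes x e0.
    by move=> i; rewrite /e0 (nth_map (cint (czero L1))) ?size_tuple // -tnth_nth.
  have [e ee h] := compl x e0 xe0 Tx; exists e => //.
  exact: encodes_agree (leqnn n) ee xe0.
move=> e /all_hold_cat[h2 h1].
have [a aE] : {a : 'I_n -> R1 & forall i : 'I_n, e i = d (a i)}.
  apply: (choice (P := fun (i : 'I_n) a => e i = d a)) => i.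
  by apply: (sound2 e h2); rewrite mem_iota /=.
have xe : encodes [tuple a i | i < n] e by move=> i; rewrite tnth_mktuple.
by exists [tuple a i | i < n] => //; exact: sound1 h1.
Qed.

End Translation.

(** Data attached to the elements of a finite type fit in a table. *)
Lemma exists_table (T : Type) (key : T -> nat) (P : T -> nat * template -> Prop) :
  finite_set [set: T] -> injective key -> (forall a, exists v, P a v) ->
  exists tab, forall a, P a (lookup tab (key a)).
Proof.
move=> finT key_inj /choice[v vP].
have /finite_seqP[s sT] : finite_set [set: {classic T}] by [].
exists [seq (key a, v a) | a <- s] => a.
suff -> : lookup [seq (key a, v a) | a <- s] (key a) = v a by [].
have : (a : {classic T}) \in s by have : [set: {classic T}] a by []; rewrite sT.
elim: s {sT} => //= b s IHs; rewrite inE.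
case: (key b =P key a) => [key_ba _|neq]; first by rewrite (key_inj _ _ key_ba).
by case/orP=> [/eqP ab|/IHs //]; rewrite ab in neq.
Qed.

Lemma finite_sum (A B : Type) :
  finite_set [set: A] -> finite_set [set: B] -> finite_set [set: A + B].
Proof.
move=> finA finB.
suff -> : [set: A + B] = (inl @` [set: A]) `|` (inr @` [set: B]).
  by rewrite finite_setU; split; exact: finite_image.
by apply/seteqP; split=> // -[a|b] _; [left; exists a | right; exists b].
Qed.

Lemma finite_option (A : Type) : finite_set [set: A] -> finite_set [set: option A].
Proof.
move=> finA; suff -> : [set: option A] = (Some @` [set: A]) `|` [set None].
  by rewrite finite_setU; split; [exact: finite_image | exact: finite_set1].
by apply/seteqP; split=> // -[a|] _; [left; exists a | right].
Qed.

(** A tuple extended with the values of [e] on the next [l] variables. *)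
Lemma tnth_cat_env (R : Type) n l (z : n.-tuple R) (e : nat -> R) :
  (forall i : 'I_n, e i = tnth z i) -> forall i : 'I_(n + l),
  e i = tnth [tuple of z ++ [tuple e (n + j) | j < l]] i.
Proof.
move=> ze i; rewrite -(fintype.splitK i); case: (fintype.split i) => j /=.
  by rewrite tnth_lshift ze.
by rewrite tnth_rshift tnth_mktuple.
Qed.

Lemma cat_tuple_split (R : Type) k l (x : (k + l).-tuple R) :
  exists (x1 : k.-tuple R) (x2 : l.-tuple R), x = [tuple of x1 ++ x2].
Proof.
exists [tuple tnth x (lshift l i) | i < k], [tuple tnth x (rshift k i) | i < l].
apply: eq_from_tnth => i; rewrite -(fintype.splitK i); case: (fintype.split i) => j /=.
  by rewrite tnth_lshift tnth_mktuple.
by rewrite tnth_rshift tnth_mktuple.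
Qed.

(** One computable function [D] together with the instances [D' n T] it produces
    from each system [T].  The clause on codes needs [last_var T = n], because
    [n] is recovered from the code; the clauses on solutions hold for all [n],
    which also gives the Diophantine image of a set whose description does not
    mention all variables. *)
Lemma exists_translation (R1 R2 : Type) (L1 : language R1) (L2 : language R2)
    (N1 : numbering L1) (N2 : numbering L2) (d : R1 -> R2) :
  finite_language L1 -> injective d ->
  (forall c : cst_sym L1, diophantine L2 [set [tuple d (cint c)]]) ->
  (forall f : fun_sym L1, diophantine L2
     [set [tuple of rcons (map_tuple d x) (d (fint f x))]
       | x in [set: (far f).-tuple R1]]) ->
  (forall S : relation L1, diophantine L2 (imaget d (relint S))) ->
  diophantine L2 [set [tuple d x] | x in [set: R1]] ->
  exists2 D : seq nat -> seq nat, computable D &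
    exists D' : forall n, system L1 n -> seq (instance L2),
    (forall n (T : system L1 n), last_var T = n ->
       D (system_code N1 T) = join_code (codes N2 (D' n T))) /\
    forall n (T : system L1 n),
      [/\ exists m, n <= m /\ all (bounded m) (D' n T),
        forall x, solution x T -> exists2 e, encodes d x e & all_hold e (D' n T)
      & forall e, all_hold e (D' n T) -> exists2 x, encodes d x e & solution x T].
Proof.
move=> [finc finf finr] d_inj d_cst d_fun d_rel d_dom.
have sym_inj : injective (fun s => 2 ^ num N1 s).
  by apply: (inj_comp (expnI (ltnSn 1))); exact: num_inj.
have d_sym (s : symbol (L1 := L1)) : exists v : nat * template,
    v.1 = sym_arity s /\ represents N2 (sym_graph d (s := s)) v.2.
  suff /(diophantine_represents N2)[q] : diophantine L2 (sym_graph d (s := s)).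
    by exists (sym_arity s, q).
  case: s => [c|f]; last exact: d_fun.
  suff <- : [set [tuple d (cint c)]] = sym_graph d (s := inl c) by [].
  apply/seteqP; split=> [_ ->|_ [x _ <-]].
    by exists [tuple] => //; exact: val_inj.
  by rewrite (tuple0 x); apply: val_inj.
have [tab tab_ok] := exists_table (finite_sum finc finf) sym_inj d_sym.
have [reltab reltab_ok] : exists reltab, forall S : relation L1,
    (lookup reltab (relnum N1 S)).1 = relar S /\
    represents N2 (imaget d (relint S)) (lookup reltab (relnum N1 S)).2.
  apply: (exists_table (P := fun (S : relation L1) v =>
    v.1 = relar S /\ represents N2 (imaget d (relint S)) v.2)).
  - exact: finite_option.
  - exact: relnum_inj.
  by move=> S; have [q] := diophantine_represents N2 (d_rel S); exists (relar S, q).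
have [dom dom_ok] := diophantine_represents N2 d_dom.
exists (translate tab reltab dom); first exact: computable_translate.
have spec n (T : system L1 n) :=
  read_system_spec d_inj tab_ok reltab_ok dom_ok T.
have /choice[D' D'P] : forall p : {n & system L1 n}, exists Js,
    (read_system tab reltab dom (tag p) (raw N1 (tagged p))).2 = codes N2 Js /\
    [/\ exists m, tag p <= m /\ all (bounded m) Js,
      forall x, solution x (tagged p) -> exists2 e, encodes d x e & all_hold e Js
    & forall e, all_hold e Js ->
        exists2 x, encodes d x e & solution x (tagged p)].
  move=> [n T] /=; have [m [Js [runE b sound complete]]] := spec n T.
  by exists Js; rewrite runE; split=> //; split=> //; exists m.
exists (fun n T => D' (existT _ n T)); split=> n T; last first.
  by have [_] := D'P (existT _ n T).
move=> lastT; have [<- _] := D'P (existT _ n T).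
rewrite /translate raw_parse ?last_index_raw ?lastT // => S.
by case: (reltab_ok S).
Qed.

Unset Implicit Arguments.

Theorem theorem1p8 (R1 R2 : Type) (L1 : language R1) (L2 : language R2)
  (N1 : numbering L1) (N2 : numbering L2)
  (finL1 : finite_language L1) (finL2 : finite_language L2)
  (h10_1 : hilbert10_exists L1) (h10_2 : hilbert10_exists L2)
  (d : R1 -> R2) (d_inj : injective d)
  (d_cst : forall c : cst_sym L1, diophantine L2 [set [tuple d (cint c)]])
  (d_fun : forall f : fun_sym L1,
     diophantine L2
       [set [tuple of rcons (map_tuple d x) (d (fint f x))]
         | x in [set: (far f).-tuple R1]])
  (d_rel : forall S : relation L1, diophantine L2 (imaget d (relint S)))
  (d_dom : diophantine L2 [set [tuple d x] | x in [set: R1]]) :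
  effective_diophantine_map N1 N2 d.
Proof.
have [D cD [D' [DE D'P]]] :=
  exists_translation N1 N2 finL1 d_inj d_cst d_fun d_rel d_dom.
split.
  move=> k _ [l [T ->]].
  have [[m [le_m b]] complete sound] := D'P _ T.
  (* One spare variable makes the number of variables nonzero. *)
  pose l' := l + (m - (k + l)).+1.
  have N_gt0 : 0 < k + l' by rewrite /l' addnS addnS.
  have {}b : all (bounded (k + l')) (D' _ T).
    apply: sub_all b => J; apply: bounded_leq.
    by rewrite /l' addnA addnS leqW // subnKC.
  exists l', (flat_system N_gt0 (D' _ T)); apply/seteqP; split.
    move=> _ [x [y Txy] <-]; have [e xe h] := complete _ Txy.
    exists [tuple e (k + j) | j < l'].
    have ze (i : 'I_k) : e i = tnth (map_tuple d x) i.
      by rewrite (xe (lshift l i)) tnth_lshift tnth_map.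
    exact: (solution_flat_system N_gt0 b (tnth_cat_env (l := l') ze)).2 h.
  move=> z [y Tzy]; pose e := nth (d (cint (czero L1))) [tuple of z ++ y].
  have ze i : e (nat_of_ord i) = tnth [tuple of z ++ y] i by rewrite /e -tnth_nth.
  have [x xe Tx] := sound e ((solution_flat_system N_gt0 b ze).1 Tzy).
  have [x1 [x2 xE]] := cat_tuple_split x.
  exists x1; first by exists x2; rewrite -xE.
  apply: eq_from_tnth => i; rewrite tnth_map -(tnth_lshift x1 x2) -xE -xe.
  by rewrite (ze (lshift l' i)) tnth_lshift.
exists D; first exact: computable_recursive_seq.
move=> n T lastT; have [[m [le_m b]] complete sound] := D'P n T.
pose l := (m - n).+1; have N_gt0 : 0 < n + l by rewrite addnS.
have {}b : all (bounded (n + l)) (D' n T).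
  by apply: sub_all b => J; apply: bounded_leq; rewrite addnS leqW // subnKC.
exists l, (flat_system N_gt0 (D' n T)); split.
- by rewrite DE // flat_system_code.
- move=> x /complete[e xe h]; exists [tuple e (n + j) | j < l].
  have ze (i : 'I_n) : e i = tnth (map_tuple d x) i by rewrite xe tnth_map.
  exact: (solution_flat_system N_gt0 b (tnth_cat_env (l := l) ze)).2 h.
move=> z y Tzy; pose e := nth (d (cint (czero L1))) [tuple of z ++ y].
have ze i : e (nat_of_ord i) = tnth [tuple of z ++ y] i by rewrite /e -tnth_nth.
have [x xe Tx] := sound e ((solution_flat_system N_gt0 b ze).1 Tzy).
exists x => //; apply: eq_from_tnth => i.
by rewrite tnth_map -xe (ze (lshift l i)) tnth_lshift.
Qed.
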